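(* Let $K$ be an infinite field and let $S=K[x_1,\dots,x_n]$ be the standard graded polynomial ring. Fix an integer $j$. Let $I\subset S$ and $J\subset S$ be homogeneous ideals. For a general change of coordinates $g\in GL_n(K)$ the following hold: (i) $\dim_K\mathrm{Tor}_i^S(S/I,S/g(J))_j\le\dim_K\mathrm{Tor}_i^S\big(S/\mathrm{Gin}_{\mathrm{lex}}(I),S/\mathrm{Gin}_{\mathrm{oplex}}(J)\big)_j$ for all $i$; (ii) $\dim_K\mathrm{Tor}_i^S(I,S/g(J))_j\le\dim_K\mathrm{Tor}_i^S\big(\mathrm{Gin}_{\mathrm{lex}}(I),S/\mathrm{Gin}_{\mathrm{oplex}}(J)\big)_j$ for all $i$.
   Context: For a graded module $M$, $M_j$ denotes its graded component of degree $j$; $\mathrm{Tor}$ modules of graded modules carry their natural grading. Each $h=(a_{ij})\in GL_n(K)$ is identified with the $K$-algebra automorphism (change of coordinates) of $S$ given by $h(x_i)=\sum_{j=1}^n a_{ji}x_j$. A property holds for a general $g\in GL_n(K)$ if there is a non-empty Zariski open subset $U\subset GL_n(K)$ such that it holds for all $g\in U$. $>_{\mathrm{lex}}$ is the lexicographic order on $S$ induced by $x_1>\cdots>x_n$ and $>_{\mathrm{oplex}}$ is the lexicographic order induced by $x_n>\cdots>x_1$. $\mathrm{Gin}_\sigma(I)$ denotes the generic initial ideal of $I$ with respect to a term order $>_\sigma$, i.e. the common value of $\mathrm{in}_\sigma(g(I))$ for general $g\in GL_n(K)$. *)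

(* Defs.v *)
From HB Require Import structures.
From mathcomp Require Import all_boot all_order all_algebra.
From mathcomp Require Import boolp classical_sets cardinality.
From mathcomp Require Import mpoly.

Set Implicit Arguments.
Unset Strict Implicit.
Unset Printing Implicit Defensive.

Import GRing.Theory.
Local Open Scope classical_set_scope.
Local Open Scope ring_scope.

Section Ideals.
Variables (K : fieldType) (n : nat).
Implicit Types (I X : set {mpoly K[n]}).

(* The unit ideal is allowed. *)
Definition ideal I : Prop :=
  [/\ I 0, forall p q, I p -> I q -> I (p + q)
    & forall a p, I p -> I (a * p)].

Definition homog_ideal I : Prop :=
  ideal I /\ forall p, I p -> forall d : nat, I (pihomog mdeg d p).

Definition ideal_span X : set {mpoly K[n]} := smallest ideal X.

(* [lt] is a strict term order: [lt m1 m2] means that X^m1 is smaller than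
   X^m2. The zero polynomial has no initial monomial. *)
Definition is_init_mon (lt : rel 'X_{1..n}) (p : {mpoly K[n]}) (m : 'X_{1..n})
    : Prop :=
  m \in msupp p /\ forall m', m' \in msupp p -> m' != m -> lt m' m.

Definition init_ideal (lt : rel 'X_{1..n}) I : set {mpoly K[n]} :=
  ideal_span [set 'X_[m] | m in [set m | exists2 p, I p & is_init_mon lt p m]].

End Ideals.

(* x_1 > ... > x_n, where x_1, ..., x_n are 'X_0, ..., 'X_(n-1) *)
Definition lex_lt (n : nat) : rel 'X_{1..n} := fun m1 m2 =>
  [exists i : 'I_n,
    (m1 i < m2 i)%N && [forall k : 'I_n, (k < i)%N ==> (m1 k == m2 k)]].

(* x_n > ... > x_1 *)
Definition oplex_lt (n : nat) : rel 'X_{1..n} := fun m1 m2 =>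
  [exists i : 'I_n,
    (m1 i < m2 i)%N && [forall k : 'I_n, (i < k)%N ==> (m1 k == m2 k)]].

Section Generic.
Variables (K : fieldType) (n : nat).

(* Open for the Zariski topology induced on GL_n by the affine space of n x n
   matrices; since det is a polynomial, inverting it gives no more opens. *)
Definition zariski_open_GL (U : set 'M[K]_n) : Prop :=
  exists P : set {mpoly K[n * n]},
    U = [set g | g \in unitmx /\
                 exists2 p, P p & p.@[fun k => mxvec g ord0 k] != 0].

Definition for_general (P : 'M[K]_n -> Prop) : Prop :=
  exists U : set 'M[K]_n,
    [/\ zariski_open_GL U, U !=set0 & forall g, U g -> P g].

(* x_i |-> \sum_j g_ji x_j *)
Definition coord_change (g : 'M[K]_n) (p : {mpoly K[n]}) : {mpoly K[n]} :=
  p \mPo [tuple \sum_(j < n) g j i *: 'X_j | i < n].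

Definition is_gin (lt : rel 'X_{1..n}) (I G : set {mpoly K[n]}) : Prop :=
  for_general (fun g => init_ideal lt (coord_change g @` I) = G).

(* For infinite K any two non-empty opens of GL_n meet, so that at most one G
   satisfies is_gin lt I G. *)
Definition Gin (lt : rel 'X_{1..n}) (I : set {mpoly K[n]})
    : set {mpoly K[n]} :=
  xget set0 (is_gin lt I).

End Generic.

Section Tor.
Variables (K : fieldType) (n : nat).
Local Notation S := {mpoly K[n]}.

(* The graded S-module num / den, for homogeneous ideals den `<=` num of S:
   this covers both S / I and I, with the gradings they get from S. *)
Record subquot := Subquot { num : set S; den : set S }.

Definition quot_mod (I : set S) := Subquot setT I.
Definition ideal_mod (I : set S) := Subquot I [set 0].

(* The component S_d, which is zero for d < 0. *)
Definition Scomp (d : int) : set S :=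
  match d with
  | Posz k => [set p | p \is k.-homog]
  | Negz _ => [set 0]
  end.

(* F_i = \bigoplus_k S(- shift i k), with elements written as row vectors, so
   that the differential F_(i+1) -> F_i is v |-> v *m diff i. The entries of
   aug represent the images in num / den of the basis of F_0. *)
Record free_data := FreeData {
  rk : nat -> nat;
  shift : forall i, 'I_(rk i) -> int;
  diff : forall i, 'M[S]_(rk i.+1, rk i);
  aug : 'cV[S]_(rk 0)
}.

Definition graded_free_resolution (M : subquot) (F : free_data) : Prop :=
  (forall k, num M (aug F k ord0) /\ Scomp (shift k) (aug F k ord0)) /\
  (forall i a b, Scomp (shift a - shift b) (diff F i a b)) /\
  (forall p, num M p ->
     exists v : 'rV[S]_(rk F 0), den M (p - (v *m aug F) ord0 ord0)) /\
  (forall v : 'rV[S]_(rk F 0),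
     den M ((v *m aug F) ord0 ord0) <-> exists w, v = w *m diff F 0) /\
  (forall i (v : 'rV[S]_(rk F i.+1)),
     v *m diff F i = 0 <-> exists w, v = w *m diff F i.+1).

(* F_i (x) N = \bigoplus_k N(- shift i k), whose elements are represented by
   row vectors with entries in num N, taken modulo entries in den N. *)
Definition tens_comp (F : free_data) (N : subquot) (i : nat) (j : int)
    : set 'rV[S]_(rk F i) :=
  [set v | forall k, num N (v ord0 k) /\ Scomp (j - shift k) (v ord0 k)].

Arguments tens_comp : clear implicits.

Definition tens_null (N : subquot) (r : nat) : set 'rV[S]_r :=
  [set v | forall k, den N (v ord0 k)].

Definition tens_cycles (F : free_data) (N : subquot) (i : nat) (j : int)
    : set 'rV[S]_(rk F i) :=
  match i return set 'rV[S]_(rk F i) with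
  | 0%N => tens_comp F N 0 j
  | i'.+1 => [set v | tens_comp F N i'.+1 j v /\ tens_null N (v *m diff F i')]
  end.

Definition tens_boundaries (F : free_data) (N : subquot) (i : nat) (j : int)
    : set 'rV[S]_(rk F i) :=
  [set v | tens_comp F N i j v /\
     exists2 w : 'rV[S]_(rk F i.+1),
       tens_comp F N i.+1 j w & tens_null N (v - w *m diff F i)].

Arguments tens_cycles : clear implicits.
Arguments tens_boundaries : clear implicits.

(* dim_K (V / W) = d, for K-subspaces W `<=` V of S^r *)
Definition is_dim_quot (r : nat) (V W : set 'rV[S]_r) (d : nat) : Prop :=
  exists b : 'I_d -> 'rV[S]_r,
    [/\ forall k, V (b k),
        forall v, V v ->
          exists c : 'I_d -> K, W (v - \sum_k (c k)%:MP_[n] *: b k)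
      & forall c : 'I_d -> K,
          W (\sum_k (c k)%:MP_[n] *: b k) -> forall k, c k = 0].

(* dim_K Tor_i(M, N)_j, where Tor_i(M, N) = H_i(F (x) N) for any graded free
   resolution F of M. *)
Definition dim_Tor (M N : subquot) (i : nat) (j : int) : nat :=
  xget 0%N [set d | exists2 F, graded_free_resolution M F &
    is_dim_quot (tens_cycles F N i j) (tens_boundaries F N i j) d].

End Tor.

(* Main.v *)
(* Tor is balanced, so dim Tor_i(M, N)_j may be computed from a fixed resolution
   F of M, as the homology in degree j of F (x) N, or from one of N. When F is
   fixed and N = S/J_u or N = J_u runs through a family whose graded components
   have bases depending polynomially on the parameter u, this dimension is a
   constant minus ranks of matrices with polynomial entries, hence upper
   semicontinuous in u.
   Choose h1 and h2 such that h1(I) and h2(J) have the generic initial ideals as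
   initial ideals. A one-parameter torus with suitable weights degenerates h2(J)
   to Gin(J), then, with the resulting translate of J fixed and resolved instead,
   another one degenerates h1(I) to Gin(I). As Tor is unchanged when one moves
   both modules by the same coordinate change, this gives one g for which the
   inequality holds; semicontinuity in g extends it to general g. The open set
   can be taken independent of i, because Tor_i(M, N)_j = 0 for i > |j| + 1. *)
Require Import Defs.
From HB Require Import structures.
From mathcomp Require Import all_boot all_order all_algebra.
From mathcomp Require Import boolp classical_sets cardinality.
From mathcomp Require Import mpoly.
From mathcomp Require Import ring zify.

Set Implicit Arguments.
Unset Strict Implicit.
Unset Printing Implicit Defensive.

Import Order.TTheory GRing.Theory Num.Theory.
Local Open Scope classical_set_scope.
Local Open Scope ring_scope.

Arguments shift {K n} f i _.
Arguments tens_comp {K n} F N i j _.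
Arguments tens_cycles {K n} F N i j _.
Arguments tens_boundaries {K n} F N i j _.

(** * Homogeneous components *)

(** [dim_Tor] picks one among the dimensions given by arbitrary resolutions, so existence and
    independence of resolutions come before any comparison. Balance, proved by hand on the double
    complex of two resolutions, gives both this independence and a symmetry that lets the moving
    ideal always be the second argument: there the differential stays fixed while the coefficients
    vary, and Tor becomes a matter of ranks over K. The overview takes the generic initial ideals
    for granted. In each single degree the initial monomials of g(I) are constant for general g, but
    infinitely many open sets need not share a point. By Dickson's lemma the candidate ideal is
    generated in finitely many degrees, and equality of Hilbert functions then settles all the
    others. A degeneration is a polynomial family over the affine line whose fibre at 0 is the
    initial ideal. Semicontinuity at 0 bounds the Tor of nearby fibres, and since K is infinite one
    of them has t nonzero, so that it is a translate of the ideal. *)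

Section Components.
Variables (K : fieldType) (n : nat).
Local Notation S := {mpoly K[n]}.
Implicit Types (p q : S) (d e : int).

Definition hcomp d p : S :=
  if d is Posz k then pihomog mdeg k p else 0.

Lemma mcoeff_hcomp d p m :
  (hcomp d p)@_m = if (mdeg m)%:Z == d then p@_m else 0.
Proof.
case: d => [k|k]; last by rewrite mcoeff0.
rewrite /hcomp pihomogE raddf_sum /= eqz_nat big_mkcond /=.
under eq_bigr do rewrite mcoeffZ mcoeffX.
have [pm|pm] := boolP (m \in msupp p).
  rewrite (bigD1_seq m) ?msupp_uniq //= big1 ?addr0 ?eqxx ?mulr1 //.
  by move=> m' /negbTE ->; rewrite mulr0 if_same.
rewrite (memN_msupp_eq0 pm) if_same big1_seq // => m' /= pm'.
have -> : (m' == m) = false by apply/eqP => e; rewrite -e pm' in pm.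
by rewrite mulr0 if_same.
Qed.

Lemma ScompP d p : Scomp d p <-> forall m, p@_m != 0 -> (mdeg m)%:Z = d.
Proof.
case: d => [k|k] /=; rewrite /mkset; split.
- by move=> /dhomogP hp m; rewrite -mcoeff_msupp => /hp ->.
- by move=> hp; apply/dhomogP => m; rewrite mcoeff_msupp => /hp; case.
- by move=> -> m; rewrite mcoeff0 eqxx.
- move=> hp; apply/mpolyP => m; rewrite mcoeff0; apply/eqP/negPn/negP.
  by move=> /hp.
Qed.

Lemma hcomp_Scomp d p : Scomp d (hcomp d p).
Proof.
apply/ScompP => m; rewrite mcoeff_hcomp.
by case: ((mdeg m)%:Z =P d) => // _; rewrite eqxx.
Qed.

Lemma hcomp_id d p : Scomp d p -> hcomp d p = p.
Proof.
move=> /ScompP hp; apply/mpolyP => m; rewrite mcoeff_hcomp.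
case: eqP => // dm; apply/esym/eqP/negPn/negP => /hp //.
Qed.

Lemma ScompE d p : Scomp d p <-> hcomp d p = p.
Proof. by split=> [/hcomp_id //|<-]; exact: hcomp_Scomp. Qed.

Lemma hcompD d : {morph hcomp d : p q / p + q}.
Proof.
move=> p q; apply/mpolyP => m; rewrite mcoeffD !mcoeff_hcomp mcoeffD.
by case: eqP => _; rewrite ?addr0.
Qed.

Lemma hcomp0 d : hcomp d 0 = 0.
Proof. by apply/mpolyP => m; rewrite mcoeff_hcomp mcoeff0 if_same. Qed.

Lemma hcompB d : {morph hcomp d : p q / p - q}.
Proof.
move=> p q; apply/mpolyP => m; rewrite mcoeffB !mcoeff_hcomp mcoeffB.
by case: eqP => _; rewrite ?subr0.
Qed.

Lemma hcomp_sum d (I : Type) (r : seq I) (P : pred I) (F : I -> S) :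
  hcomp d (\sum_(i <- r | P i) F i) = \sum_(i <- r | P i) hcomp d (F i).
Proof. exact: (big_morph _ (hcompD d) (hcomp0 d)). Qed.

Lemma hcompM d e p q : Scomp e q -> hcomp d (p * q) = hcomp (d - e) p * q.
Proof.
move=> /ScompP hq; apply/mpolyP => m; rewrite mcoeff_hcomp !mcoeffM.
rewrite (fun_if (fun x => x = _)); case: eqP => dm.
  apply: eq_bigr => k /eqP em; rewrite mcoeff_hcomp.
  have [->|/hq dq] := eqVneq q@_(k.2) 0; first by rewrite !mulr0.
  rewrite ifT //; apply/eqP.
  have : mdeg m = (mdeg k.1 + mdeg k.2)%N by rewrite -mdegD -em.
  by move: (mdeg m) (mdeg k.1) (mdeg k.2) dm dq => a b c; lia.
rewrite big1 // => k /eqP em; rewrite mcoeff_hcomp.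
have [->|/hq dq] := eqVneq q@_(k.2) 0; first by rewrite !mulr0.
rewrite ifF ?mul0r //; apply/eqP => ed; apply: dm.
have : mdeg m = (mdeg k.1 + mdeg k.2)%N by rewrite -mdegD -em.
by move: (mdeg m) (mdeg k.1) (mdeg k.2) ed dq => a b c; lia.
Qed.

Lemma Scomp0 d : Scomp d (0 : S).
Proof. by apply/ScompE; rewrite hcomp0. Qed.

Lemma ScompD d p q : Scomp d p -> Scomp d q -> Scomp d (p + q).
Proof. by move=> /ScompE hp /ScompE hq; apply/ScompE; rewrite hcompD hp hq. Qed.

Lemma ScompM d e p q : Scomp d p -> Scomp e q -> Scomp (d + e) (p * q).
Proof.
move=> /ScompE hp hq; apply/ScompE; rewrite (hcompM _ _ hq).
by rewrite -{2}hp; congr (hcomp _ _ * _); ring.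
Qed.

Lemma ScompC (c : K) : Scomp 0 (c%:MP : S).
Proof.
apply/ScompP => m; rewrite mcoeffC; case: (m =P 0%MM) => [->|_].
  by rewrite mdeg0.
by rewrite mulr0 eqxx.
Qed.

Lemma ScompCM d (c : K) p : Scomp d p -> Scomp d (c%:MP * p).
Proof. by move=> hp; rewrite -(add0r d); apply: ScompM (ScompC c) hp. Qed.

Lemma ScompN d p : Scomp d p -> Scomp d (- p).
Proof. by move=> /(ScompCM (-1)); rewrite mpolyCN mpolyC1 mulN1r. Qed.

Lemma ScompB d p q : Scomp d p -> Scomp d q -> Scomp d (p - q).
Proof. by move=> hp /ScompN; exact: ScompD. Qed.

Lemma Scomp_sum d (I : Type) (r : seq I) (P : pred I) (F : I -> S) :
  (forall i, P i -> Scomp d (F i)) -> Scomp d (\sum_(i <- r | P i) F i).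
Proof.
by move=> hF; apply: (big_ind _ (Scomp0 d) (@ScompD d)).
Qed.

Lemma ScompX m : Scomp (mdeg m)%:Z ('X_[m] : S).
Proof.
apply/ScompP => m'; rewrite mcoeffX.
by case: (m =P m') => [-> //|]; rewrite eqxx.
Qed.

Lemma sum_hcomp p : p = \sum_(k < msize p) hcomp k%:Z p.
Proof. exact: pihomog_partitionE. Qed.

Lemma Scomp_lt0 d p : d < 0 -> Scomp d p -> p = 0.
Proof. by case: d. Qed.

Lemma Scomp_msize d p : Scomp d p -> p != 0 -> (msize p)%:Z = d + 1.
Proof.
move=> /ScompP hp p0; rewrite -(mlead_deg p0).
have := mlead_supp p0; rewrite mcoeff_msupp => /hp <-; lia.
Qed.

End Components.

Section Ideals.
Variables (K : fieldType) (n : nat).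
Local Notation S := {mpoly K[n]}.
Implicit Types (I : set S).

Lemma ideal_sum I (A : Type) (r : seq A) (P : pred A) (F : A -> S) :
  ideal I -> (forall i, P i -> I (F i)) -> I (\sum_(i <- r | P i) F i).
Proof. by move=> [I0 ID _] hF; apply: (big_ind I I0 ID). Qed.

Lemma idealN I p : ideal I -> I p -> I (- p).
Proof. by move=> [_ _ IM] /(IM (-1)); rewrite mulN1r. Qed.

Lemma idealB I p q : ideal I -> I p -> I q -> I (p - q).
Proof. by move=> hI Ip Iq; have [_ ID _] := hI; apply: ID => //; exact: idealN. Qed.

Lemma ideal0 : ideal [set (0 : S)].
Proof.
by split=> [//|p q /= -> ->|a p /= ->]; rewrite /mkset ?addr0 ?mulr0.
Qed.

Lemma idealT : ideal [set: S]. Proof. by []. Qed.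

Lemma homog_ideal0 : homog_ideal [set (0 : S)].
Proof. by split=> [|p /= -> d]; [exact: ideal0|rewrite /mkset pihomog0]. Qed.

Lemma homog_idealT : homog_ideal [set: S]. Proof. by []. Qed.

Lemma homog_hcomp I p d : homog_ideal I -> I p -> I (hcomp d p).
Proof. by move=> [[I0 _ _] hI] Ip; case: d => k //=; exact: hI. Qed.

Lemma homog_ideal_hcomp I : ideal I -> (forall p d, I p -> I (hcomp d p)) ->
  homog_ideal I.
Proof. by move=> hI h; split=> // p Ip d; exact: (h p d%:Z). Qed.

End Ideals.

(** * Matrices of degree 0 maps between graded free modules *)

Section HomogeneousMatrices.
Variables (K : fieldType) (n : nat).
Local Notation S := {mpoly K[n]}.

(** Encodes a degree 0 map from the sum of the S(- e x) to the sum of the S(- s y), acting on row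
    vectors. A homogeneous vector of degree j is the case of one row with [e] constantly j. *)
Definition homog_mx a b (e : 'I_a -> int) (s : 'I_b -> int) (A : 'M[S]_(a, b)) :=
  forall x y, Scomp (e x - s y) (A x y).

Definition hcomp_mx a b (e : 'I_a -> int) (s : 'I_b -> int) (A : 'M[S]_(a, b)) :=
  \matrix_(x, y) hcomp (e x - s y) (A x y).

Lemma hcomp_mx_homog a b (e : 'I_a -> int) (s : 'I_b -> int) A :
  homog_mx e s (hcomp_mx e s A).
Proof. by move=> x y; rewrite mxE; exact: hcomp_Scomp. Qed.

Lemma hcomp_mx_id a b (e : 'I_a -> int) (s : 'I_b -> int) A :
  homog_mx e s A -> hcomp_mx e s A = A.
Proof. by move=> hA; apply/matrixP => x y; rewrite mxE hcomp_id. Qed.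

(** Exactness of a resolution is stated without degrees. By this identity a solution [A] of
    [A *m B = C] with [B] and [C] homogeneous remains a solution when replaced by [hcomp_mx e s A],
    which is how homogeneous lifts are obtained. *)
Lemma hcomp_mxM a b c (e : 'I_a -> int) (s : 'I_b -> int) (t : 'I_c -> int) A B :
  homog_mx s t B -> hcomp_mx e t (A *m B) = hcomp_mx e s A *m B.
Proof.
move=> hB; apply/matrixP => x y; rewrite !mxE hcomp_sum; apply: eq_bigr => z _.
by rewrite (hcompM _ _ (hB z y)) mxE; congr (hcomp _ _ * _); ring.
Qed.

Lemma homog_mxM a b c (e : 'I_a -> int) (s : 'I_b -> int) (t : 'I_c -> int) A B :
  homog_mx e s A -> homog_mx s t B -> homog_mx e t (A *m B).
Proof.
move=> hA hB; rewrite -(hcomp_mx_id hA) -(hcomp_mxM _ _ hB); exact: hcomp_mx_homog.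
Qed.

Lemma homog_mxB a b (e : 'I_a -> int) (s : 'I_b -> int) A B :
  homog_mx e s A -> homog_mx e s B -> homog_mx e s (A - B).
Proof. by move=> hA hB x y; rewrite !mxE; apply: ScompB. Qed.

Lemma homog_mxD a b (e : 'I_a -> int) (s : 'I_b -> int) A B :
  homog_mx e s A -> homog_mx e s B -> homog_mx e s (A + B).
Proof. by move=> hA hB x y; rewrite !mxE; apply: ScompD. Qed.

Lemma homog_mx0 a b (e : 'I_a -> int) (s : 'I_b -> int) : homog_mx e s 0.
Proof. by move=> x y; rewrite mxE; apply: Scomp0. Qed.

Lemma homog_mxC a b (e : 'I_a -> int) (s : 'I_b -> int) (c : K) A :
  homog_mx e s A -> homog_mx e s (c%:MP *: A).
Proof. by move=> hA x y; rewrite mxE; apply: ScompCM. Qed.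

Lemma ideal_mulmx (I : set S) a b c (A : 'M[S]_(a, b)) (B : 'M[S]_(b, c)) x y :
  ideal I -> (forall z, I (B z y)) -> I ((A *m B) x y).
Proof.
by move=> hI hB; rewrite mxE; apply: ideal_sum => // z _; have [_ _] := hI; apply.
Qed.

Lemma ideal_mulmxl (I : set S) a b c (A : 'M[S]_(a, b)) (B : 'M[S]_(b, c)) x y :
  ideal I -> (forall z, I (A x z)) -> I ((A *m B) x y).
Proof.
move=> hI hA; rewrite mxE; apply: ideal_sum => // z _.
by rewrite mulrC; have [_ _] := hI; apply.
Qed.

End HomogeneousMatrices.

(** * Balance of Tor *)

Section Balance.
Variables (K : fieldType) (n : nat).
Local Notation S := {mpoly K[n]}.
Implicit Types (M N : subquot K n) (F Q : free_data K n).

Definition homog_subquot M :=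
  [/\ homog_ideal (num M), homog_ideal (den M) & den M `<=` num M].

Lemma homog_quot_mod (I : set S) : homog_ideal I -> homog_subquot (quot_mod I).
Proof. by move=> hI; split. Qed.

Lemma homog_ideal_mod (I : set S) : homog_ideal I -> homog_subquot (ideal_mod I).
Proof. by move=> hI; split=> //=; [exact: homog_ideal0|move=> p ->;
  case: hI => -[]]. Qed.

(** Cycles of the augmented complex, one in each row. At q = 0 the target is num N / den N instead
    of a free module, hence the separate case. *)
Definition res_cycle N Q q a : 'M[S]_(a, rk Q q) -> Prop :=
  match q with
  | 0%N => fun A => forall x, den N ((A *m aug Q) x ord0)
  | q'.+1 => fun A => A *m diff Q q' = 0
  end.

Lemma diff_homog N Q q : graded_free_resolution N Q ->
  homog_mx (shift Q q.+1) (shift Q q) (diff Q q).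
Proof. by move=> [_ [h _]]; exact: h. Qed.

Lemma aug_homog N Q : graded_free_resolution N Q ->
  homog_mx (shift Q 0) (fun _ : 'I_1 => 0) (aug Q).
Proof. by move=> [h _] x y; rewrite ord1 subr0; case: (h x). Qed.

Lemma res_cycle_diff N Q q a (W : 'M[S]_(a, rk Q q.+1)) :
  graded_free_resolution N Q -> res_cycle N (W *m diff Q q).
Proof.
move=> [_ [_ [_ [h0 h1]]]]; case: q W => [|q] W /=.
  move=> x; have := (h0 (row x (W *m diff Q 0))).2.
  rewrite -row_mul mxE; apply; exists (row x W); exact: row_mul.
apply/row_matrixP => x; rewrite row_mul row0; apply/h1; exists (row x W).
exact: row_mul.
Qed.

Lemma diff_diff N Q q : graded_free_resolution N Q ->
  diff Q q.+1 *m diff Q q = 0.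
Proof. by move=> hQ; have := res_cycle_diff (1%:M : 'M_(rk Q q.+2)) hQ;
  rewrite /= mul1mx. Qed.

Lemma diff_aug N Q x : graded_free_resolution N Q ->
  den N ((diff Q 0 *m aug Q) x ord0).
Proof.
move=> hQ; have := @res_cycle_diff N Q 0 _ 1%:M hQ.
by rewrite mul1mx; apply.
Qed.

Lemma res_lift N Q q a (e : 'I_a -> int) (A : 'M[S]_(a, rk Q q)) :
  graded_free_resolution N Q -> homog_mx e (shift Q q) A ->
  res_cycle N A ->
  exists W, homog_mx e (shift Q q.+1) W /\ A = W *m diff Q q.
Proof.
move=> hQ hA cA.
have [W0 W0P] : exists W0, A = W0 *m diff Q q.
  have /choice[w wP] : forall x, exists w, row x A = w *m diff Q q.
    have [_ [_ [_ [h0 h1]]]] := hQ.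
    case: q A {hA} cA => [|q] A /= cA x; first by apply/h0; rewrite -row_mul mxE.
    by apply/h1; rewrite -row_mul cA row0.
  exists (\matrix_x w x); apply/row_matrixP => x.
  by rewrite row_mul rowK -wP.
exists (hcomp_mx e (shift Q q.+1) W0); split; first exact: hcomp_mx_homog.
by rewrite -(hcomp_mxM _ _ (diff_homog hQ)) -W0P hcomp_mx_id.
Qed.

Lemma res_lift_aug N Q a (e : 'I_a -> int) (c : 'cV[S]_a) :
  homog_subquot N -> graded_free_resolution N Q ->
  (forall x, num N (c x ord0)) -> (forall x, Scomp (e x) (c x ord0)) ->
  exists A : 'M[S]_(a, rk Q 0), homog_mx e (shift Q 0) A /\
    forall x, den N (c x ord0 - (A *m aug Q) x ord0).
Proof.
move=> [_ hd _] hQ nc hc.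
have /choice[v vP] : forall x, exists v : 'rV_(rk Q 0),
    den N (c x ord0 - (v *m aug Q) ord0 ord0).
  by have [_ [_ [h _]]] := hQ; move=> x; apply: h.
exists (hcomp_mx e (shift Q 0) (\matrix_x v x)).
split=> [|x]; first exact: hcomp_mx_homog.
rewrite -(hcomp_mxM _ _ (aug_homog hQ)) !mxE.
have := homog_hcomp (e x) hd (vP x).
rewrite hcompB hcomp_id // subr0; congr (den N (_ - hcomp _ _)).
by rewrite mxE; apply: eq_bigr => y _; rewrite mxE.
Qed.

Section Zigzag.
Variables (M N : subquot K n) (F Q : free_data K n) (j : int).
Hypotheses (hM : homog_subquot M) (hN : homog_subquot N).
Hypotheses (hF : graded_free_resolution M F) (hQ : graded_free_resolution N Q).

(* The entries of a zigzag lie in the double complex F (x) Q: X p q represents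
   an element of F_p (x) Q_q. *)
Definition zigzag i (X : forall p q, 'M[S]_(rk F p, rk Q q))
    (z : 'rV[S]_(rk F i)) (z' : 'rV[S]_(rk Q i)) :=
  [/\ forall p q, (p + q)%N = i ->
        homog_mx (fun x => j - shift F p x) (shift Q q) (X p q),
      forall p q, (p + q).+1 = i ->
        (diff F p)^T *m X p.+1 q = X p q.+1 *m diff Q q,
      forall x, den N (z ord0 x - (X i 0 *m aug Q) x ord0)
    & forall y, den M (z' ord0 y - ((aug F)^T *m X 0 i) ord0 y)].

Let rows p (x : 'I_(rk F p)) := j - shift F p x.

Lemma homog_trmx_diff p : homog_mx (@rows p) (@rows p.+1) (diff F p)^T.
Proof.
move=> x y; rewrite mxE /rows; have := diff_homog hF y x.
by congr (Scomp _ _); ring.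
Qed.

(** The cycle is pushed along the antidiagonal by exactness of [Q]: the first lift exists because
    [z] is a cycle modulo [den N], the later ones because the differential of [F] squares to
    zero. *)
Lemma zigzag_total i (z : 'rV[S]_(rk F i)) : tens_cycles F N i j z ->
  exists X z', zigzag X z z' /\ tens_cycles Q M i j z'.
Proof.
move=> hz; have zc : tens_comp F N i j z by case: i z hz => [|i'] z // [].
have [|x|A [hA A_z]] := @res_lift_aug N Q _ (@rows i) z^T hN hQ.
- by move=> x; rewrite mxE; case: (zc x).
- by rewrite mxE; case: (zc x).
(* [A] is placed at p = i, with a cast because the type depends on p. Off the antidiagonal p + q = i
   the entries, and the default of [xget] below, are junk about which nothing is claimed. *)
pose X0 p : 'M[S]_(rk F p, rk Q 0) :=
  match @eqP _ i p with
  | ReflectT e => ecast p ('M[S]_(rk F p, rk Q 0)) e A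
  | ReflectF _ => 0
  end.
have X0i : X0 i = A by rewrite /X0; case: eqP => // e; rewrite eq_axiomK.
(* The recursion is on q for all p at once, since the entry at (p, q + 1) lifts the image of the
   entry at (p + 1, q). *)
pose fix X q : forall p, 'M[S]_(rk F p, rk Q q) :=
  if q is q'.+1 then fun p =>
    xget 0 [set W | homog_mx (@rows p) (shift Q q'.+1) W /\
                    (diff F p)^T *m X q' p.+1 = W *m diff Q q']
  else X0.
have Xi : X 0%N i = A := X0i.
have XS q p : (p + q).+1 = i ->
    homog_mx (@rows p.+1) (shift Q q) (X q p.+1) ->
    res_cycle N ((diff F p)^T *m X q p.+1) ->
    homog_mx (@rows p) (shift Q q.+1) (X q.+1 p) /\
    (diff F p)^T *m X q p.+1 = X q.+1 p *m diff Q q.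
  move=> pq hX cX; apply: (@xgetPex _ 0 [set W | homog_mx (@rows p) (shift Q q.+1)
    W /\
    (diff F p)^T *m X q p.+1 = W *m diff Q q]).
  by apply: (res_lift hQ) => //; apply: homog_mxM hX; exact: homog_trmx_diff.
have XP q p : (p + q)%N = i -> homog_mx (@rows p) (shift Q q) (X q p) /\
    (forall p', p = p'.+1 -> res_cycle N ((diff F p')^T *m X q p'.+1)).
  elim: q p => [|q IHq] p pq.
    rewrite addn0 in pq; subst p; split; first by rewrite Xi.
    move=> p' ip x; subst i; rewrite Xi /=.
    have [_ nz] := hz; have [_ [hd _] _] := hN; rewrite -mulmxA.
    (* [A *m aug Q] agrees with [z^T] modulo [den N] and [z] is a cycle, so both terms on the right
       lie in [den N]. *)
    have -> : (diff F p')^T *m (A *m aug Q) =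
        (z *m diff F p')^T - (diff F p')^T *m (z^T - A *m aug Q).
      by rewrite mulmxBr -trmx_mul opprB addrC subrK.
    rewrite !mxE; apply: idealB => //; first by have := nz x; rewrite !mxE.
    apply: ideal_sum => // k _; have [_ _] := hd; apply; have := A_z k.
    by rewrite !mxE.
  have [hX cX] := IHq p.+1 (etrans (addSnnS p q) pq).
  have [|hX1 eX1] := XS q p _ hX (cX _ erefl); first by rewrite -addnS.
  split=> // p' ep; subst p => /=.
  by rewrite -mulmxA -eX1 mulmxA -trmx_mul (diff_diff _ hF) trmx0 mul0mx.
exists (fun p q => X q p), ((aug F)^T *m X i 0%N).
have hX0 := (XP i 0%N (add0n i)).1.
split.
  split=> [p q pq|p q pq|x|y].
  - by case: (XP q p pq).
  - have pq' : (p.+1 + q)%N = i by rewrite addSn.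
    by have [hX cX] := XP q p.+1 pq'; have [] := XS q p pq hX (cX _ erefl).
  - by have := A_z x; rewrite Xi !mxE.
  - by rewrite subrr; have [_ [[]]] := hM.
have [[nM _] [dM _] _] := hM.
have cz' : tens_comp Q M i j ((aug F)^T *m X i 0%N).
  move=> k; split.
    apply: ideal_mulmxl => // x; rewrite mxE; have [hh _] := hF.
    by case: (hh x).
  rewrite mxE; apply: Scomp_sum => x _; rewrite mxE.
  have := ScompM (aug_homog hF x ord0) (hX0 x k).
  by congr (Scomp _ _); rewrite /rows; ring.
case: i {z hz zc A hA A_z X0 X0i Xi} X XS XP hX0 cz' => [|i'] //= X XS XP hX0 cz'.

split=> // k; have [hX1 cX1] := XP i' 1%N (add1n i').
have [|_ eX1] := XS i' 0%N _ hX1 (cX1 _ erefl); first by rewrite add0n.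
rewrite -mulmxA -eX1 mulmxA -trmx_mul; apply: ideal_mulmxl => // x; rewrite mxE.
exact: diff_aug hF.
Qed.

(** If [z] bounds, so does the whole zigzag: a family Y on the antidiagonal p + q = i + 1, starting
    from a lift of [w], satisfies X_(p,q) = d^T Y_(p+1,q) + Y_(p,q+1) d. At p = 0 the augmentation
    of [F] sends the first term into [den M], and the second shows that [z'] is a boundary. *)
Lemma zigzag_boundary i X (z : 'rV[S]_(rk F i)) z' :
  zigzag X z z' -> tens_comp Q M i j z' -> tens_boundaries F N i j z ->
  tens_boundaries Q M i j z'.
Proof.
move=> [hX eX Xz Xz'] hz' [_ [w hw zw]].
have [|x|A [hA A_w]] := @res_lift_aug N Q _ (@rows i.+1) w^T hN hQ.
- by move=> x; rewrite mxE; case: (hw x).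
- by rewrite mxE; case: (hw x).
pose Y0 p : 'M[S]_(rk F p, rk Q 0) :=
  match @eqP _ i.+1 p with
  | ReflectT e => ecast p ('M[S]_(rk F p, rk Q 0)) e A
  | ReflectF _ => 0
  end.
pose fix Y q : forall p, 'M[S]_(rk F p, rk Q q) :=
  if q is q'.+1 then fun p =>
    xget 0 [set W | homog_mx (@rows p) (shift Q q'.+1) W /\
                    X p q' - (diff F p)^T *m Y q' p.+1 = W *m diff Q q']
  else Y0.
have Yi : Y 0%N i.+1 = A.
  by rewrite /= /Y0; case: eqP => // e; rewrite eq_axiomK.
have YS q p : (p + q)%N = i ->
    homog_mx (@rows p.+1) (shift Q q) (Y q p.+1) ->
    res_cycle N (X p q - (diff F p)^T *m Y q p.+1) ->
    homog_mx (@rows p) (shift Q q.+1) (Y q.+1 p) /\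
    X p q - (diff F p)^T *m Y q p.+1 = Y q.+1 p *m diff Q q.
  move=> pq hY cY; apply: (@xgetPex _ 0 [set W | homog_mx (@rows p) (shift Q q.+1)
    W /\
    X p q - (diff F p)^T *m Y q p.+1 = W *m diff Q q]).
  apply: (res_lift hQ) => //; apply: homog_mxB; first exact: hX.
  by apply: homog_mxM hY; exact: homog_trmx_diff.
have YP q p : (p + q)%N = i -> homog_mx (@rows p.+1) (shift Q q) (Y q p.+1) /\
    res_cycle N (X p q - (diff F p)^T *m Y q p.+1).
  have [_ [hd _] _] := hN.
  elim: q p => [|q IHq] p pq.
    rewrite addn0 in pq; subst p; rewrite Yi; split=> // x.
    rewrite mulmxBl -mulmxA.
    have -> : (diff F i)^T *m (A *m aug Q) =
        (w *m diff F i)^T - (diff F i)^T *m (w^T - A *m aug Q).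
      by rewrite mulmxBr -trmx_mul opprB addrC subrK.
    have Xzx := Xz x; have zwx := zw x.
    have Ax : den N (((diff F i)^T *m (w^T - A *m aug Q)) x ord0).
      by apply: ideal_mulmx => // k; have := A_w k; rewrite !mxE.
    have := idealB hd (idealB hd zwx Xzx) (idealN hd Ax).
    by congr (den N _); rewrite !mxE; ring.
  have [hY cY] := IHq p.+1 (etrans (addSnnS p q) pq).
  have [|hY1 eY1] := YS q p.+1 _ hY cY; first by rewrite addSnnS.
  split=> //=; rewrite mulmxBl -mulmxA -eY1 mulmxBr -eX; last by rewrite -addnS.
  by rewrite mulmxA -trmx_mul (diff_diff _ hF) trmx0 mul0mx subr0 subrr.
have [hY cY] := YP i 0%N (add0n i).
have [hY1 eY1] := YS i 0%N (add0n i) hY cY.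
have [[nM _] [dM _] _] := hM.
split=> //; exists ((aug F)^T *m Y i.+1 0%N).
  move=> k; split.
    apply: ideal_mulmxl => // x; rewrite mxE; have [hh _] := hF.
    by case: (hh x).
  rewrite mxE; apply: Scomp_sum => x _; rewrite mxE.
  have := ScompM (aug_homog hF x ord0) (hY1 x k).
  by congr (Scomp _ _); rewrite /rows; ring.
move=> k; rewrite -mulmxA -eY1 mulmxBr mulmxA -trmx_mul.
have dk : den M (((diff F 0 *m aug F)^T *m Y i 1%N) ord0 k).
  apply: ideal_mulmxl => // x; rewrite mxE.
  exact: diff_aug hF.
have [_ ID _] := dM; have := ID _ _ (Xz' k) dk.
by congr (den M _); rewrite !mxE; ring.
Qed.

End Zigzag.

(** The squares of a zigzag commute without signs, so its relations are symmetric in the two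
    resolutions and the two lemmas above also serve in the reverse direction. *)
Lemma zigzag_tr M N F Q i j X (z : 'rV[S]_(rk F i)) z' :
  @zigzag M N F Q j i X z z' ->
  @zigzag N M Q F j i (fun p q => (X q p)^T) z' z.
Proof.
move=> [hX eX Xz Xz']; split.
- move=> p q pq x y; rewrite mxE; rewrite addnC in pq.
  by have := hX _ _ pq y x; congr (Scomp _ _); ring.
- move=> p q pq; rewrite addnC in pq.
  by apply: trmx_inj; rewrite !trmx_mul !trmxK eX.
- move=> y; have := Xz' y.
  by rewrite -[(X 0 i)^T *m _]trmxK trmx_mul trmxK [_^T y _]mxE.
- by move=> y; have := Xz y; rewrite -trmx_mul [_^T _ y]mxE.
Qed.

End Balance.

(** * Dimension of a quotient V / W *)

Section QuotientDimension.
Variables (K : fieldType) (n : nat).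
Local Notation S := {mpoly K[n]}.

Definition subspace r (V : set 'rV[S]_r) :=
  V 0 /\ forall (c : K) a b, V a -> V b -> V (a + c%:MP *: b).

Lemma subspace_sum r (V : set 'rV[S]_r) d (c : 'I_d -> K) b :
  subspace V -> (forall k, V (b k)) -> V (\sum_k (c k)%:MP_[n] *: b k).
Proof.
move=> [V0 VD] Vb; elim/big_rec: _ => // k v _ Vv; rewrite addrC; exact: VD.
Qed.

Lemma subspaceB r (V : set 'rV[S]_r) a b :
  subspace V -> V a -> V b -> V (a - b).
Proof. by move=> [_ VD] Va /(VD (-1) _ _ Va); rewrite mpolyCN mpolyC1 scaleN1r. Qed.

(** [R] induces an isomorphism from V / W to V' / W'. It is a relation and not a map because a
    zigzag involves choices and determines the class of its other end only. *)
Lemma is_dim_quot_rel r r' (V W : set 'rV[S]_r) (V' W' : set 'rV[S]_r')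
    (R : 'rV[S]_r -> 'rV[S]_r' -> Prop) d :
  R 0 0 ->
  (forall (c : K) a b a' b', R a a' -> R b b' ->
     R (a + c%:MP *: b) (a' + c%:MP *: b')) ->
  subspace V -> subspace V' ->
  (forall v, V v -> exists2 v', V' v' & R v v') ->
  (forall v', V' v' -> exists2 v, V v & R v v') ->
  (forall v v', R v v' -> V v -> V' v' -> (W v <-> W' v')) ->
  is_dim_quot V W d -> is_dim_quot V' W' d.
Proof.
move=> R0 RD sV sV' tR tR' RW [b [Vb sp ind]].
have /choice[b' b'P] : forall k, exists v', V' v' /\ R (b k) v'.
  by move=> k; have [v' ? ?] := tR _ (Vb k); exists v'.
have Rsum (c : 'I_d -> K) :
    R (\sum_k (c k)%:MP_[n] *: b k) (\sum_k (c k)%:MP_[n] *: b' k).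
  elim/big_rec2: _ => // k v v' _ Rv; rewrite ![_ *: _ + _]addrC.
  by apply: RD => //; case: (b'P k).
have Vb' k : V' (b' k) by case: (b'P k).
exists b'; split=> // [v' Vv'|c Wc].
  have [v Vv Rv] := tR' _ Vv'; have [c Wc] := sp v Vv; exists c.
  apply/(RW (v - \sum_k (c k)%:MP_[n] *: b k)) => //.
  - have := RD (-1) _ _ _ _ Rv (Rsum c).
    by rewrite mpolyCN mpolyC1 !scaleN1r.
  - by apply: subspaceB => //; apply: subspace_sum.
  - by apply: subspaceB => //; apply: subspace_sum.
apply: ind; apply/(RW _ _ (Rsum c)) => //; exact: subspace_sum.
Qed.

(** The matrices [A] and [A'] that express each basis in the other modulo [W] satisfy [A *m A' = 1],
    because the first family is independent modulo [W]. *)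
Lemma is_dim_quot_le r (V W : set 'rV[S]_r) d d' : subspace W ->
  is_dim_quot V W d -> is_dim_quot V W d' -> (d <= d')%N.
Proof.
move=> sW [b [Vb sp ind]] [b' [Vb' sp' ind']].
have /choice[C CP] : forall k, exists c : 'I_d' -> K,
  W (b k - \sum_l (c l)%:MP_[n] *: b' l) by move=> k; apply: sp'.
have /choice[C' C'P] : forall l, exists c : 'I_d -> K,
  W (b' l - \sum_k (c k)%:MP_[n] *: b k) by move=> l; apply: sp.
pose A : 'M[K]_(d, d') := \matrix_(k, l) C k l.
pose A' : 'M[K]_(d', d) := \matrix_(l, k) C' l k.
apply: (@mulmx1_min _ _ _ A A'); apply/row_matrixP => k.
suff h : forall m, (\row_m ((A *m A') k m - (1%:M : 'M_d) k m)) ord0 m = 0.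
  by apply/rowP => m; apply/eqP; rewrite !mxE -subr_eq0; have := h m;
    rewrite !mxE => ->.
move=> m; pose c m := (A *m A') k m - (1%:M : 'M_d) k m.
rewrite mxE; apply: (ind c) => {m}.
have -> : \sum_m (c m)%:MP_[n] *: b m =
  - (b k - \sum_l (C k l)%:MP *: b' l)
  - \sum_l (C k l)%:MP *: (b' l - \sum_m (C' l m)%:MP *: b m).
  rewrite (eq_bigr (fun m => (\sum_l (C k l)%:MP *: ((C' l m)%:MP *: b m))
      - ((1%:M : 'M[K]_d) k m)%:MP *: b m)); last first.
    move=> m _; rewrite /c mpolyCB scalerBl mxE raddf_sum /= scaler_suml.
    congr (_ - _); apply: eq_bigr => l _; rewrite !mxE mpolyCM scalerA //.
  rewrite sumrB exchange_big /=.
  have -> : \sum_m ((1%:M : 'M[K]_d) k m)%:MP_[n] *: b m = b k.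
    rewrite (bigD1 k) //= mxE eqxx mpolyC1 scale1r big1 ?addr0 // => m /negbTE mk.
    by rewrite mxE eq_sym mk scale0r.
  under [X in _ = _ - X]eq_bigr do rewrite scalerBr scaler_sumr.
  by rewrite sumrB opprB opprB [RHS]addrC addrA addrNK.
apply: subspaceB => //; last exact: subspace_sum.
by rewrite -sub0r; apply: subspaceB => //; case: sW.
Qed.

Lemma is_dim_quot_uniq r (V W : set 'rV[S]_r) d d' : subspace W ->
  is_dim_quot V W d -> is_dim_quot V W d' -> d = d'.
Proof.
move=> sW h h'; apply/eqP; rewrite eqn_leq.
by rewrite (is_dim_quot_le sW h h') (is_dim_quot_le sW h' h).
Qed.

End QuotientDimension.

Section TorBalance.
Variables (K : fieldType) (n : nat).
Local Notation S := {mpoly K[n]}.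
Implicit Types (M N : subquot K n) (F Q : free_data K n).

Lemma subspace_tens_null N r : homog_subquot N -> subspace (@tens_null _ _ N r).
Proof.
move=> [_ [[d0 dD dM] _] _]; split=> [k|c a b ha hb k]; rewrite mxE //.
by rewrite mxE; apply: dD => //; apply: dM.
Qed.

Lemma subspace_tens_comp F N i j : homog_subquot N ->
  subspace (tens_comp F N i j).
Proof.
move=> [[[d0 dD dM] _] _ _]; split=> [k|c a b ha hb k]; rewrite !mxE.
  by split=> //; apply: Scomp0.
have [a1 a2] := ha k; have [b1 b2] := hb k.
split; first by apply: dD => //; apply: dM.
by apply: ScompD => //; apply: ScompCM.
Qed.

Lemma subspace_tens_cycles F N i j : homog_subquot N ->
  subspace (tens_cycles F N i j).
Proof.
move=> hN; case: i => [|i]; first exact: subspace_tens_comp.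
have [c0 cD] := subspace_tens_comp F i.+1 j hN.
have [n0 nD] := subspace_tens_null (rk F i) hN.
split=> [|c a b [ha na] [hb nb]]; first by split=> //; rewrite mul0mx.
by split; [exact: cD|rewrite mulmxDl -scalemxAl; exact: nD].
Qed.

Lemma subspace_tens_boundaries F N i j : homog_subquot N ->
  subspace (tens_boundaries F N i j).
Proof.
move=> hN.
have [c0 cD] := subspace_tens_comp F i j hN.
have [c0' cD'] := subspace_tens_comp F i.+1 j hN.
have [n0 nD] := subspace_tens_null (rk F i) hN.
split=> [|c a b [ha [wa wa1 wa2]] [hb [wb wb1 wb2]]].
  by split=> //; exists 0 => //; rewrite mul0mx subrr.
split; first exact: cD.
exists (wa + c%:MP *: wb); first exact: cD'.
have := nD c _ _ wa2 wb2; congr (tens_null _ _).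
by rewrite mulmxDl -scalemxAl scalerBr opprD !addrA; congr (_ - _); rewrite addrAC.
Qed.

(** Since [F] and [Q] are arbitrary, applying this twice, through a resolution of [N], also gives
    independence of the resolution of [M]. *)
Theorem tor_balance M N F Q i j d : homog_subquot M -> homog_subquot N ->
  graded_free_resolution M F -> graded_free_resolution N Q ->
  is_dim_quot (tens_cycles F N i j) (tens_boundaries F N i j) d ->
  is_dim_quot (tens_cycles Q M i j) (tens_boundaries Q M i j) d.
Proof.
move=> hM hN hF hQ.
have cyc_comp F' N' (z : 'rV_(rk F' i)) :
    tens_cycles F' N' i j z -> tens_comp F' N' i j z.
  by case: i z => [|i'] z // [].
apply: (@is_dim_quot_rel _ _ _ _ _ _ _ _
  (fun z z' => exists X, @zigzag _ _ M N F Q j i X z z')).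
- exists (fun p q => 0); have [_ [[dM _ _] _] _] := hM; have [_ [[dN _ _] _] _] := hN.
  split=> [p q _|p q _|x|y]; rewrite ?mulmx0 ?mul0mx //; last 2 first.
  + by rewrite !mxE subrr.
  + by rewrite !mxE subrr.
  exact: homog_mx0.
- move=> c a b a' b' [X [hX eX Xz Xz']] [Y [hY eY Yz Yz']].
  exists (fun p q => X p q + c%:MP *: Y p q).
  have [_ [[_ dMD dMM] _] _] := hM; have [_ [[_ dND dNM] _] _] := hN.
  split=> [p q pq|p q pq|x|y].
  + by apply: homog_mxD; [exact: hX|apply: homog_mxC; exact: hY].
  + rewrite mulmxDr mulmxDl (eX _ _ pq); congr (_ + _).
    by rewrite -scalemxAl -(eY _ _ pq) scalemxAr.
  + have := dND _ _ (Xz x) (dNM c%:MP _ (Yz x)); congr (den N _).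
    rewrite mulmxDl -scalemxAl [(a + _) _ _]mxE [(_ *: b) _ _]mxE.
    rewrite [(_ *m aug Q + _) _ _]mxE [(_ *: (_ *m _)) _ _]mxE; ring.
  + have := dMD _ _ (Xz' y) (dMM c%:MP _ (Yz' y)); congr (den M _).
    rewrite mulmxDr -(scalemxAr c%:MP) [(a' + _) _ _]mxE [(_ *: b') _ _]mxE.
    rewrite [((aug F)^T *m _ + _) _ _]mxE [(_ *: (_ *m _)) _ _]mxE; ring.
- exact: subspace_tens_cycles.
- exact: subspace_tens_cycles.
- move=> z hz; have [X [z' [h1 h2]]] := zigzag_total hM hN hF hQ hz.
  by exists z' => //; exists X.
- move=> z' hz'; have [X [z [h1 h2]]] := zigzag_total hN hM hQ hF hz'.
  by exists z => //; eexists; exact: zigzag_tr h1.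
- move=> z z' [X hX] hz hz'; split;
  first exact: (zigzag_boundary hM hN hF hQ hX (cyc_comp _ _ _ hz')).
  exact: (zigzag_boundary hN hM hQ hF (zigzag_tr hX) (cyc_comp _ _ _ hz)).
Qed.

Definition is_dim_Tor M N i j d := exists2 F, graded_free_resolution M F &
  is_dim_quot (tens_cycles F N i j) (tens_boundaries F N i j) d.

End TorBalance.

(** * Graded free resolutions *)

Section Dickson.
Variable n : nat.

(** Induction on the number of compared exponents. If the next exponent of [m] is at least that of
    every element of [s], then [s] serves for [m]; otherwise this exponent takes one of finitely
    many values, and each value gives a slice to which the induction hypothesis applies. *)
Lemma dickson_partial k (L : set 'X_{1..n}) : exists s : seq 'X_{1..n},
  (forall m, m \in s -> L m) /\
  forall m, L m -> exists2 g, g \in s & forall i : 'I_n, (i < k)%N -> (g i <= m i)%N.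
Proof.
elim: k L => [|k IHk] L.
  have [[m Lm]|L0] := pselect (exists m, L m).
    exists [:: m]; split=> [m'|m' _]; first by rewrite inE => /eqP ->.
    by exists m; rewrite ?inE.
  by exists [::]; split=> // m Lm; case: L0; exists m.
have [kn|nk] := ltnP k n; last first.
  have [s [sL Ls]] := IHk L; exists s; split=> // m /Ls[g gs gm].
  by exists g => // i _; apply: gm; apply: leq_trans (ltn_ord i) nk.
pose k' := Ordinal kn.
have [s [sL Ls]] := IHk L.
have /choice[sl slP] : forall h, exists s' : seq 'X_{1..n},
    (forall m, m \in s' -> L m /\ m k' = h) /\
    forall m, L m /\ m k' = h ->
      exists2 g, g \in s' & forall i : 'I_n, (i < k)%N -> (g i <= m i)%N.
  by move=> h; apply: (IHk [set m | L m /\ m k' = h]).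
pose H := \max_(g <- s) g k'.
exists (s ++ flatten [seq sl h | h <- iota 0 H]); split=> [m|m Lm].
  rewrite mem_cat => /orP[/sL //|/flatten_mapP[h _ mh]].
  by have [/(_ _ mh)[]] := slP h.
have split_k g : (forall i : 'I_n, (i < k)%N -> (g i <= m i)%N) ->
    (g k' <= m k')%N -> forall i : 'I_n, (i < k.+1)%N -> (g i <= m i)%N.
  move=> gm gk i; rewrite ltnS leq_eqVlt => /orP[/eqP ik|]; last exact: gm.
  by have -> : i = k' by apply: val_inj.
have [Hm|mH] := leqP H (m k').
  have [g gs gm] := Ls m Lm; exists g; first by rewrite mem_cat gs.
  apply: split_k => //; apply: leq_trans Hm.
  by rewrite /H (big_rem g) //= leq_maxl.
have [h1 h2] := slP (m k'); have [g gs gm] := h2 m (conj Lm erefl).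
exists g; last by apply: split_k => //; rewrite (h1 g gs).2.
rewrite mem_cat; apply/orP; right; apply/flatten_mapP; exists (m k') => //.
by rewrite mem_iota.
Qed.

Lemma dickson (L : set 'X_{1..n}) : exists s : seq 'X_{1..n},
  (forall m, m \in s -> L m) /\
  forall m, L m -> exists2 g, g \in s & (g <= m)%MM.
Proof.
have [s [sL Ls]] := dickson_partial n L; exists s; split=> // m /Ls[g gs gm].
by exists g => //; apply/mnm_lepP => i; apply: gm.
Qed.

End Dickson.

(** * Finite and minimal generation of graded submodules *)

Section GradedSubmodules.
Variables (K : fieldType) (n : nat).
Local Notation S := {mpoly K[n]}.

Definition graded_sub r (s : 'I_r -> int) (N : set 'rV[S]_r) :=
  [/\ N 0, forall u v, N u -> N v -> N (u + v), forall p v, N v -> N (p *: v)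
    & forall j v, N v -> N (hcomp_mx (fun _ => j) s v)].

Definition generates r (s : 'I_r -> int) (N : set 'rV[S]_r) m (t : 'I_m -> int)
    (G : 'M[S]_(m, r)) :=
  [/\ homog_mx t s G, forall a, N (row a G)
    & forall v, N v -> exists w : 'rV_m, v = w *m G].

Lemma graded_sub_mulmx r (s : 'I_r -> int) N m (w : 'rV[S]_m) G :
  graded_sub s N -> (forall a, N (row a G)) -> N (w *m G).
Proof.
move=> [N0 ND NM _] NG; rewrite mulmx_sum_row.
by apply: (big_ind N) => // a _; apply: NM.
Qed.

Lemma hcomp_lead d (p : S) : (mdeg (mlead p))%:Z = d ->
  p != 0 -> hcomp d p != 0 /\ mlead (hcomp d p) = mlead p.
Proof.
move=> dp p0; have cm : (hcomp d p)@_(mlead p) != 0.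
  by rewrite mcoeff_hcomp dp eqxx mleadc_eq0.
have h0 : hcomp d p != 0 by apply: contraNneq cm => ->; rewrite mcoeff0.
split=> //; apply/le_anti/andP; split; last by rewrite msupp_le_mlead ?mcoeff_msupp.
apply: msupp_le_mlead; rewrite mcoeff_msupp.
have := mlead_supp h0; rewrite mcoeff_msupp mcoeff_hcomp.
by case: ifP => // _; rewrite eqxx.
Qed.

(** Division for a position over term order, the lead of a vector being the leading monomial of its
    first nonzero entry. Dickson's lemma at each position yields finitely many vectors, and
    reduction by them terminates. *)
Lemma graded_sub_gen r (s : 'I_r -> int) N : graded_sub s N ->
  exists m (t : 'I_m -> int) G, generates s N t G.
Proof.
move=> [N0 ND NM NH].
pose lead (k : 'I_r) m (v : 'rV[S]_r) :=
  [/\ v ord0 k != 0, mlead (v ord0 k) = m & forall k' : 'I_r, (k' < k)%N ->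
    v ord0 k' = 0].
have /choice[B BP] : forall k, exists s' : seq 'X_{1..n},
    (forall m, m \in s' -> exists2 v, N v & lead k m v) /\
    forall m, (exists2 v, N v & lead k m v) -> exists2 g, g \in s' & (g <= m)%MM.
  by move=> k; exact: (dickson [set m | exists2 v, N v & lead k m v]).
(* Each vector is replaced by its homogeneous component in the degree of its lead, which has the
   same lead. *)
have /choice[g0 g0P] : forall km : 'I_r * 'X_{1..n}, exists u : int * 'rV[S]_r,
    (exists2 v, N v & lead km.1 km.2 v) ->
    [/\ N u.2, homog_mx (fun _ => u.1) s u.2 & lead km.1 km.2 u.2].
  move=> [k m] /=; have [[v Nv lv]|?] := pselect (exists2 v, N v & lead k m v);
    last by exists (0, 0).
  pose e := (mdeg m)%:Z + s k; exists (e, hcomp_mx (fun _ => e) s v) => _ /=.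
  split; [exact: NH|exact: hcomp_mx_homog|].
  case: lv => v0 vm vz; rewrite /lead mxE.
  have [||h0 hm] := @hcomp_lead (e - s k) (v ord0 k) => //.
    by rewrite vm /e; ring.
  by rewrite hm; split=> // k' /vz; rewrite mxE => ->; rewrite hcomp0.
pose gs := flatten [seq [seq g0 (k, m) | m <- B k] | k <- enum 'I_r].
have gsP u : u \in gs -> N u.2 /\ homog_mx (fun _ => u.1) s u.2.
  move=> /flatten_mapP[k _ /mapP[m mB ->]].
  by case: (g0P (k, m)) => //=; have [h _] := BP k; apply: h.
exists (size gs), (fun a => (nth (0, 0) gs a).1), (\matrix_a (nth (0, 0) gs a).2).
have row_gs (a : 'I_(size gs)) : row a (\matrix_a (nth (0, 0) gs a).2) = (nth (0,
  0) gs a).2.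
  by rewrite rowK.
split.
- by move=> a b; rewrite mxE; have [_ h] := gsP _ (mem_nth (0, 0) (ltn_ord a));
  apply: h.
- by move=> a; rewrite row_gs; have [] := gsP _ (mem_nth (0, 0) (ltn_ord a)).
set G := \matrix_a _ in row_gs *.
(* Outer induction on the number [k] of last entries that may be nonzero; the inner one is on the
   leading monomial of the first of these. *)
suff P k : (k <= r)%N -> forall v : 'rV_r, N v ->
    (forall k' : 'I_r, (k' < r - k)%N -> v ord0 k' = 0) -> exists w :
      'rV_(size gs), v = w *m G.
  by move=> v Nv; apply: (P r) => // k'; rewrite subnn.
elim: k => [_|k IHk kr] v Nv vz.
  exists 0; rewrite mul0mx; apply/rowP => k'; rewrite mxE vz //.
  by rewrite subn0.
have rk_lt : (r - k.+1 < r)%N by lia.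
pose kk := Ordinal rk_lt.
move: {2}(mlead (v ord0 kk)) (erefl (mlead (v ord0 kk))) => m.
elim/(well_founded_ind (@ltom_wf n)): m v Nv vz => m IHm v Nv vz vm.
have [vk0|vk0] := eqVneq (v ord0 kk) 0.
  apply: IHk => // [|k' k'l]; first exact: ltnW.
  have [k'l'|] := ltnP k' (r - k.+1); first exact: vz.
  move=> k'g; suff -> : k' = kk by [].
  by apply: val_inj => /=; lia.
have lv : lead kk m v by split.
have [g gB gm] : exists2 g, g \in B kk & (g <= m)%MM.
  by have [_ h] := BP kk; apply: h; exists v.
have [|Nu hu [u0 um uz]] := g0P (kk, g); first by have [h _] := BP kk; apply: h.
set u := g0 (kk, g) in Nu hu u0 um uz; rewrite /= in u0 um uz.
pose c := (v ord0 kk)@_m / (u.2 ord0 kk)@_g.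
pose q : S := c *: 'X_[m - g].
have ug0 : (u.2 ord0 kk)@_g != 0 by rewrite -um mleadc_eq0.
have vm0 : (v ord0 kk)@_m != 0 by rewrite -vm mleadc_eq0.
have c0 : c != 0 by rewrite mulf_neq0 ?invr_eq0.
have q0 : q != 0.
  rewrite scaler_eq0 negb_or c0 /=; apply/eqP => /mpolyP/(_ (m - g)%MM)/eqP.
  by rewrite mcoeffX eqxx mcoeff0 oner_eq0.
have lq : mlead (q * u.2 ord0 kk) = m.
  by rewrite mleadM // /q mleadZ // mleadXm um submK.
have cq : (q * u.2 ord0 kk)@_m = (v ord0 kk)@_m.
  rewrite [X in _@_X = _](esym (submK gm)) /q -scalerAl mcoeffZ.
  by rewrite ['X_[_] * _]mulrC mcoeffMX /c mulfVK.
pose v' := v - q *: u.2.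
have [w' v'w] : exists w : 'rV_(size gs), v' = w *m G.
- have Nv' : N v' by rewrite /v' -scaleN1r; apply: ND => //; do 2!apply: (NM).
  have v'z (k' : 'I_r) : (k' < r - k.+1)%N -> v' ord0 k' = 0.
    by move=> kl; rewrite !mxE vz // uz // mulr0 subrr.
  have [v'k0|v'k0] := eqVneq (v' ord0 kk) 0.
    apply: IHk => // [|k' k'l]; first exact: ltnW.
    have [k'l'|] := ltnP k' (r - k.+1); first exact: v'z.
    move=> k'g; suff -> : k' = kk by [].
    by apply: val_inj => /=; lia.
  apply: (IHm (mlead (v' ord0 kk))) => //.
  have e : v' ord0 kk = v ord0 kk - q * u.2 ord0 kk by rewrite !mxE.
  rewrite lt_neqAle; apply/andP; split.
    apply/eqP => h; move: v'k0; rewrite -mleadc_eq0 h e mcoeffB cq subrr.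
    by rewrite eqxx.
  by rewrite e; apply: le_trans (mleadB_le _ _) _; rewrite vm lq joinxx.
have uG : u \in gs.
  by apply/flatten_mapP; exists kk; rewrite ?mem_enum //; apply/mapP; exists g.
have ui : (index u gs < size gs)%N by rewrite index_mem.
exists (w' + q *: delta_mx ord0 (Ordinal ui)).
by rewrite mulmxDl -v'w -scalemxAl -rowE row_gs /= nth_index // subrK.
Qed.

Lemma generates_remove r (s : 'I_r -> int) N m (t : 'I_m.+1 -> int) G a
    (w' : 'rV[S]_m.+1) : generates s N t G -> w' ord0 a = 0 ->
  row a G = w' *m G ->
  generates s N (fun b => t (lift a b)) (row' a G).
Proof.
move=> [hG NG gen] w'a aG; split=> [x y|b|v Nv].
- by rewrite mxE.
- suff -> : row b (row' a G) = row (lift a b) G by [].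
  by apply/rowP => y; rewrite !mxE.
have [w ->] := gen v Nv.
pose x := w - w ord0 a *: delta_mx ord0 a + w ord0 a *: w'.
have xa : x ord0 a = 0 by rewrite !mxE !eqxx w'a mulr1 mulr0 subrr addr0.
exists (col' a x).
have -> : w *m G = x *m G.
  by rewrite /x mulmxDl mulmxBl -!scalemxAl -rowE aG subrK.
apply/rowP => y; rewrite !mxE (bigD1_ord a) //= xa mul0r add0r.
by apply: eq_bigr => b _; rewrite !mxE.
Qed.

(* For a minimal number of generators, a relation with a nonzero constant
   coefficient would make a generator redundant. *)
Lemma graded_sub_mingen r (s : 'I_r -> int) N (c : int) : graded_sub s N ->
  (forall j v, N v -> homog_mx (fun _ => j) s v -> v != 0 -> c <= j) ->
  exists m (t : 'I_m -> int) G, [/\ generates s N t G, forall a, c <= t a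
    & forall j (w : 'rV_m), homog_mx (fun _ => j) t w -> w *m G = 0 -> w != 0 ->
      c + 1 <= j].
Proof.
move=> gN lbN.
have ex : exists m, `[< exists (t : 'I_m -> int) G, generates s N t G >].
  by have [m [t [G gG]]] := graded_sub_gen gN; exists m; apply/asboolP; exists t, G.
case: (ex_minnP ex) => m /asboolP[t [G gG]] mmin.
have no_red a (w' : 'rV[S]_m) : w' ord0 a = 0 -> row a G <> w' *m G.
  case: m t G gG mmin a w' => [|m] t G gG mmin a w'; first by case: a.
  move=> w'a aG; suff : (m.+1 <= m)%N by rewrite ltnn.
  apply: mmin; apply/asboolP; exists (fun b => t (lift a b)), (row' a G).
  exact: generates_remove gG w'a aG.
have [hG NG gen] := gG.
have ct a : c <= t a.
  apply: (lbN _ (row a G)) => //; first by move=> x y; rewrite mxE.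
  by apply/eqP => a0; apply: (no_red a 0); rewrite ?mxE // mul0mx.
exists m, t, G; split=> // j w hw wG w0.
have [a wa] : exists a, w ord0 a != 0.
  apply/existsP; apply: contraR w0 => /existsPn w0; apply/eqP/rowP => a.
  by rewrite mxE; apply/eqP; have := w0 a; rewrite negbK.
have := Scomp_msize (hw ord0 a) wa => sz.
have szp : (0 < msize (w ord0 a))%N by rewrite lt0n msize_poly_eq0.
have [/eqP/msize_poly1P[k k0 wk]|sz1] := eqVneq (msize (w ord0 a)) 1%N.
  exfalso; apply: (no_red a (delta_mx ord0 a - (k^-1)%:MP *: w)).
    by rewrite !mxE !eqxx wk -mpolyCM mulVf // mpolyC1 subrr.
  by rewrite mulmxBl -rowE -scalemxAl wG scaler0 subr0.
have := ct a; lia.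
Qed.

End GradedSubmodules.

(** * Construction of graded free resolutions *)

Section Resolutions.
Variables (K : fieldType) (n : nat).
Local Notation S := {mpoly K[n]}.

Lemma graded_sub_kernel r (s : 'I_r -> int) m (t : 'I_m -> int) (G : 'M[S]_(m, r)) :
  homog_mx t s G -> graded_sub t [set w | w *m G = 0].
Proof.
move=> hG; split=> [|u v /= u0 v0|p v /= v0|j v /= v0]; rewrite /mkset.
- by rewrite mul0mx.
- by rewrite mulmxDl u0 v0 addr0.
- by rewrite -scalemxAl v0 scaler0.
- rewrite -(hcomp_mxM _ _ hG) v0; apply/matrixP => x y.
  by rewrite !mxE hcomp0.
Qed.

Lemma graded_sub_ideal m (t : 'I_m -> int) (g : 'cV[S]_m) (I : set S) :
  homog_ideal I -> homog_mx t (fun _ => 0) g ->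
  graded_sub t [set w | I ((w *m g) ord0 ord0)].
Proof.
move=> hI hg; have [[I0 ID IM] _] := hI.
split=> [|u v /= u0 v0|p v /= v0|j v /= v0]; rewrite /mkset.
- by rewrite mul0mx mxE.
- by rewrite mulmxDl mxE; apply: ID.
- by rewrite -scalemxAl mxE; apply: IM.
- by rewrite -(hcomp_mxM _ _ hg) mxE; apply: homog_hcomp.
Qed.

(** The current module of relations, bundled with its ambient free module because the rank changes
    at each step of the iteration. [st_low] bounds from below the degrees of its nonzero homogeneous
    elements; minimality of the covers makes this bound rise by one per step. *)
Record gsub_state := GsubState {
  st_rk : nat;
  st_shift : 'I_st_rk -> int;
  st_set : set 'rV[S]_st_rk;
  st_low : nat;
  st_sub : graded_sub st_shift st_set;
  st_lowP : forall j v, st_set v -> homog_mx (fun _ => j) st_shift v -> v != 0 ->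
    st_low%:Z <= j }.

Record gsub_cover (st : gsub_state) := GsubCover {
  cov_rk : nat;
  cov_shift : 'I_cov_rk -> int;
  cov_mx : 'M[S]_(cov_rk, st_rk st);
  cov_gen : generates (@st_shift st) (@st_set st) cov_shift cov_mx;
  cov_low : forall a, (st_low st)%:Z <= cov_shift a;
  cov_ker : forall j (w : 'rV_cov_rk), w *m cov_mx = 0 ->
    homog_mx (fun _ => j) cov_shift w -> w != 0 -> (st_low st).+1%:Z <= j }.

Lemma gsub_cover_ex st : inhabited (gsub_cover st).
Proof.
have [m [t [G [gG ct ker]]]] := graded_sub_mingen (st_sub st) (@st_lowP st).
apply: inhabits; apply: (@GsubCover st m t G gG ct) => j w wG hw w0.
by have := ker j w hw wG w0; lia.
Qed.

Definition the_cover st : gsub_cover st := inhabited_witness (gsub_cover_ex st).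

Definition next_state st : gsub_state :=
  let c := the_cover st in
  @GsubState (cov_rk c) (@cov_shift st c) [set w | w *m cov_mx c = 0]
    (st_low st).+1 (graded_sub_kernel (let: And3 h _ _ := cov_gen c in h))
    (@cov_ker st c).

(** The bound on the shifts is what makes Tor_i vanish in a fixed degree for large i. *)
Theorem resolution_exists (M : subquot K n) : homog_subquot M ->
  exists2 F, graded_free_resolution M F &
    forall i k, i%:Z <= shift F i.+1 k.
Proof.
move=> [hn hd dn].
pose N : set 'rV[S]_1 := [set v | num M (v ord0 ord0)].
have gN : graded_sub (fun _ => 0) N.
  have := @graded_sub_ideal 1 (fun _ => 0) 1%:M (num M) hn.
  have -> : [set w : 'rV_1 | num M ((w *m 1%:M) ord0 ord0)] = N.
    by apply/seteqP; split=> w; rewrite /mkset mulmx1.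
  apply; move=> x y; rewrite !ord1 mxE eqxx subrr; exact: (ScompC n 1).
have Scomp_ge0 d (p : S) : Scomp d p -> p != 0 -> 0 <= d.
  move=> hp p0; have := Scomp_msize hp p0.
  have : (0 < msize p)%N by rewrite lt0n msize_poly_eq0.
  lia.
have row_neq0 r (v : 'rV[S]_r) : v != 0 -> exists a, v ord0 a != 0.
  move=> v0; apply/existsP; apply: contraR v0 => /existsPn v0; apply/eqP/rowP => a.
  by rewrite mxE; apply/eqP; have := v0 a; rewrite negbK.
have [|m [t [g [[hg Ng gen] ct _]]]] := graded_sub_mingen gN (c := 0).
  move=> j v _ hv /row_neq0[a va]; rewrite -(subr0 j); exact: Scomp_ge0 (hv _ _) va.
have gK := graded_sub_ideal hd hg.
(* The bound is 0 and not 1, since generators that are minimal for [num M] may still have relations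
   modulo [den M] with constant coefficients. Hence the shifts in step i + 1 are only bounded by
   i. *)
have lK j (v : 'rV[S]_m) : [set w | den M ((w *m g) ord0 ord0)] v ->
    homog_mx (fun _ => j) t v -> v != 0 -> 0%N%:Z <= j.
  move=> _ hv /row_neq0[a va]; have := Scomp_ge0 _ _ (hv _ _) va; have := ct a; lia.
pose st0 := GsubState gK lK.
pose st i := iter i next_state st0.
pose F := @FreeData K n (fun i => st_rk (st i)) (fun i => @st_shift (st i))
  (fun i => cov_mx (the_cover (st i))) g.
exists F.
  split; [|split; [|split; [|split]]].
  - move=> k; split.
      by have := Ng k; rewrite /N /mkset mxE.
    by have := hg k ord0; rewrite subr0.
  - by move=> i a b; have [h _ _] := cov_gen (the_cover (st i)); exact: h.
  - move=> p np; have [w wP] := gen (\row__ p) (eq_ind_r (num M) np (mxE _ _ _ _)).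
    exists w; rewrite -wP mxE subrr; by case: hd => -[].
  - move=> v; split.
      by have [_ _ h] := cov_gen (the_cover (st 0)); exact: h.
    have [_ h _] := cov_gen (the_cover (st 0)).
    by move=> [w ->]; exact: (graded_sub_mulmx w (st_sub (st 0)) h).
  - move=> i v; split.
      by have [_ _ h] := cov_gen (the_cover (st i.+1)); exact: h.
    have [_ h _] := cov_gen (the_cover (st i.+1)).
    by move=> [w ->]; exact: (graded_sub_mulmx w (st_sub (st i.+1)) h).
have lo i : st_low (st i) = i by elim: i => //= i ->.
move=> i k; by have := @cov_low _ (the_cover (st i)) k; rewrite lo.
Qed.

End Resolutions.

(** * Semicontinuity *)

Section RegularFunctions.
Variables (K : fieldType) (N : nat).
Implicit Types (f g : 'rV[K]_N -> K).

Definition regular f := exists p : {mpoly K[N]}, forall u, f u = p.@[fun k =>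
  u ord0 k].

Lemma regular_const c : regular (fun _ => c).
Proof. by exists c%:MP => u; rewrite mevalC. Qed.

Lemma regular_coord k : regular (fun u => u ord0 k).
Proof. by exists 'X_k => u; rewrite mevalXU. Qed.

Lemma regularD f g : regular f -> regular g -> regular (fun u => f u + g u).
Proof. by move=> [p fp] [q gq]; exists (p + q) => u; rewrite mevalD fp gq. Qed.

Lemma regularM f g : regular f -> regular g -> regular (fun u => f u * g u).
Proof. by move=> [p fp] [q gq]; exists (p * q) => u; rewrite mevalM fp gq. Qed.

Lemma regular_sum (I : Type) (r : seq I) (P : pred I) (F : I -> 'rV[K]_N -> K) :
  (forall i, P i -> regular (F i)) -> regular (fun u => \sum_(i <- r | P i) F i u).
Proof.
move=> hF; elim: r => [|i r IHr].
  by under eq_fun do rewrite big_nil; exact: regular_const.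
under eq_fun do rewrite big_cons.
by case: (boolP (P i)) => // Pi; apply: regularD => //; apply: hF.
Qed.

Lemma regular_prod (I : Type) (r : seq I) (P : pred I) (F : I -> 'rV[K]_N -> K) :
  (forall i, P i -> regular (F i)) -> regular (fun u => \prod_(i <- r | P i) F i u).
Proof.
move=> hF; elim: r => [|i r IHr].
  by under eq_fun do rewrite big_nil; exact: regular_const.
under eq_fun do rewrite big_cons.
by case: (boolP (P i)) => // Pi; apply: regularM => //; apply: hF.
Qed.

Lemma regularX f k : regular f -> regular (fun u => f u ^+ k).
Proof.
move=> hf; elim: k => [|k IHk]; first exact: regular_const.
by under eq_fun do rewrite exprS; exact: regularM.
Qed.

Definition regular_mx m k (A : 'rV[K]_N -> 'M[K]_(m, k)) :=
  forall x y, regular (fun u => A u x y).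

Lemma regular_mx_const m k (A : 'M[K]_(m, k)) : regular_mx (fun _ => A).
Proof. by move=> x y; exact: regular_const. Qed.

Lemma regular_mulmx m k l (A : 'rV[K]_N -> 'M[K]_(m, k)) (B : 'rV[K]_N -> 'M[K]_(k,
  l)) :
  regular_mx A -> regular_mx B -> regular_mx (fun u => A u *m B u).
Proof.
move=> hA hB x y; under eq_fun do rewrite mxE.
by apply: regular_sum => z _; apply: regularM.
Qed.

Lemma regular_col_mx m k l (A : 'rV[K]_N -> 'M[K]_(m, l)) (B : 'rV[K]_N ->
  'M[K]_(k, l)) :
  regular_mx A -> regular_mx B -> regular_mx (fun u => col_mx (A u) (B u)).
Proof.
move=> hA hB x y; under eq_fun do rewrite mxE.
by case: (split x).
Qed.

Lemma regular_det m (A : 'rV[K]_N -> 'M[K]_m) :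
  regular_mx A -> regular (fun u => \det (A u)).
Proof.
move=> hA; rewrite /determinant; apply: regular_sum => s _.
by apply: regularM; [exact: regular_const|apply: regular_prod].
Qed.

Definition open_near (u0 : 'rV[K]_N) (P : 'rV[K]_N -> Prop) :=
  exists f, [/\ regular f, f u0 != 0 & forall u, f u != 0 -> P u].

Lemma open_nearI u0 P Q : open_near u0 P -> open_near u0 Q ->
  open_near u0 (fun u => P u /\ Q u).
Proof.
move=> [f [rf f0 fP]] [g [rg g0 gQ]]; exists (fun u => f u * g u); split.
- exact: regularM.
- by rewrite mulf_neq0.
- by move=> u; rewrite mulf_eq0 negb_or => /andP[/fP ? /gQ ?].
Qed.

Lemma open_nearS u0 (P Q : _ -> Prop) : (forall u, P u -> Q u) ->
  open_near u0 P -> open_near u0 Q.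
Proof. by move=> PQ [f [rf f0 fP]]; exists f; split=> // u /fP/PQ. Qed.

(** [P] and [Q] reduce [A u0] to the identity of size r, so the determinant below is 1 at [u0];
    where it is nonzero, [A u] has rank at least r. *)
Lemma open_near_rank m k (A : 'rV[K]_N -> 'M[K]_(m, k)) u0 :
  regular_mx A -> open_near u0 (fun u => (\rank (A u0) <= \rank (A u))%N).
Proof.
move=> hA; set r := \rank (A u0).
pose P : 'M[K]_(r, m) := pid_mx r *m invmx (col_ebase (A u0)).
pose Q : 'M[K]_(k, r) := invmx (row_ebase (A u0)) *m pid_mx r.
exists (fun u => \det (P *m A u *m Q)); split.
- by apply: regular_det; do ?[apply: regular_mulmx|exact: regular_mx_const].
- rewrite -{1}(mulmx_ebase (A u0)) /P /Q !mulmxA mulmxKV ?col_ebase_unit //.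
  rewrite mulmxK ?row_ebase_unit // pid_mx_id ?rank_leq_row //.
  by rewrite pid_mx_id ?rank_leq_col // pid_mx_1 det1 oner_neq0.
- move=> u; rewrite -unitfE -unitmxE => /mxrank_unit <-.
  by apply: leq_trans (mxrankM_maxl _ _) _; apply: mxrankM_maxr.
Qed.

Hypothesis hK : infinite_set [set: K].

Lemma infinite_nonroot (p : {poly K}) : p != 0 -> exists t, p.[t] != 0.
Proof.
move=> p0; have [//|noroot] := pselect (exists t, p.[t] != 0).
have allroot t : root p t.
  by rewrite rootE; apply/negPn/negP => h; apply: noroot; exists t.
have [B _ sB] := infinite_set_fset (size p) hK.
have : all (root p) (finmap.enum_fset B) by apply/allP => t _.
move=> /(max_poly_roots p0)/(_ (finmap.fset_uniq B)).
by rewrite ltnNge sB.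
Qed.

Lemma regular_line f (a b : 'rV[K]_N) : regular f ->
  exists p : {poly K}, forall t, p.[t] = f (a + t *: b).
Proof.
move=> [q fq].
exists (mmap (@polyC K) (fun k => (a ord0 k)%:P + 'X * (b ord0 k)%:P) q) => t.
rewrite fq /meval /mmap /mmap1 horner_sum; apply: eq_bigr => m _.
rewrite hornerM hornerC horner_prod; congr (_ * _); apply: eq_bigr => k _.
by rewrite horner_exp hornerD hornerM !hornerC hornerX !mxE.
Qed.

(** Irreducibility of affine space over an infinite field: on the line through [u] and [v] both
    functions become nonzero polynomials in one variable, and their product has a non-root. *)
Lemma regular_nonvanishing2 f g u v : regular f -> regular g ->
  f u != 0 -> g v != 0 -> exists w, f w != 0 /\ g w != 0.
Proof.
move=> /(regular_line u (v - u))[p fp] /(regular_line u (v - u))[q gq] fu gv.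
have p0 : p != 0.
  by apply: contraNneq fu => p0; have := fp 0; rewrite p0 horner0 scale0r addr0 => <-.
have q0 : q != 0.
  apply: contraNneq gv => q0; have := gq 1.
  by rewrite q0 horner0 scale1r addrC subrK => <-.
have [t] := infinite_nonroot (mulf_neq0 p0 q0).
rewrite hornerM fp gq mulf_eq0 negb_or => /andP[ft gt].
by eexists; split; [exact: ft|exact: gt].
Qed.

End RegularFunctions.

(** * Rows of bounded degree as vectors over K *)

Section Coordinates.
Variables (K : fieldType) (n D : nat).
Local Notation S := {mpoly K[n]}.

Definition cidx r : finType := ('I_r * 'X_{1..n < D})%type.
Local Notation cdim r := #|{: cidx r}|.

Definition cval r (x : 'I_(cdim r)) : 'I_r * 'X_{1..n < D} := enum_val x.

(** Terms of degree at least [D] are forgotten, so this is faithful only on [bounded] rows; [msize]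
    is the degree plus one, whence the bound [msize <= D] there. *)
Definition coords r (v : 'rV[S]_r) : 'rV[K]_(cdim r) :=
  \row_x (v ord0 (cval x).1)@_((cval x).2).

Definition monvec r (x : 'I_(cdim r)) : 'rV[S]_r :=
  'X_[(cval x).2] *: delta_mx ord0 (cval x).1.

Definition uncoords r (c : 'rV[K]_(cdim r)) : 'rV[S]_r :=
  \sum_x (c ord0 x)%:MP_[n] *: monvec x.

Definition bounded r (v : 'rV[S]_r) := forall k, (msize (v ord0 k) <= D)%N.

Lemma coords_lin r (c : K) (a b : 'rV[S]_r) :
  coords (a + c%:MP *: b) = coords a + c *: coords b.
Proof. by apply/rowP => x; rewrite !mxE mcoeffD mcoeffCM. Qed.

Lemma coords0 r : coords (0 : 'rV[S]_r) = 0.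
Proof. by apply/rowP => x; rewrite !mxE mcoeff0. Qed.

Lemma coords_sum r (I : finType) (c : I -> K) (v : I -> 'rV[S]_r) :
  coords (\sum_i (c i)%:MP *: v i) = \sum_i c i *: coords (v i).
Proof.
elim/big_rec2: _ => [|i a b _ <-]; first exact: coords0.
by rewrite addrC coords_lin addrC.
Qed.

Lemma coordsD r (a b : 'rV[S]_r) : coords (a + b) = coords a + coords b.
Proof. by have := coords_lin 1 a b; rewrite mpolyC1 !scale1r. Qed.

Lemma coordsB r (a b : 'rV[S]_r) : coords (a - b) = coords a - coords b.
Proof. by have := coords_lin (-1) a b; rewrite mpolyCN mpolyC1 !scaleN1r. Qed.

Lemma coords_monvec r (x : 'I_(cdim r)) : coords (monvec x) = delta_mx ord0 x.
Proof.
apply/rowP => y; rewrite /coords /monvec !mxE eqxx /=.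
have -> : (y == x) = (cval y == cval x) by rewrite (inj_eq enum_val_inj).
case: (cval x) (cval y) => [k m] [k' m'] /=.
rewrite xpair_eqE; case: eqP => _; last by rewrite mulr0 mcoeff0.
by rewrite mulr1 mcoeffX eq_sym.
Qed.

Lemma uncoordsK r : cancel (@uncoords r) (@coords r).
Proof.
move=> c; rewrite coords_sum; under eq_bigr do rewrite coords_monvec.
by rewrite -row_sum_delta.
Qed.

Lemma coordsK r (v : 'rV[S]_r) : bounded v -> uncoords (coords v) = v.
Proof.
move=> bv; apply/rowP => k; rewrite [in RHS](mpolywE (bv k)) summxE.
rewrite (reindex (@enum_rank (cidx r))) /=; last first.
  by exists enum_val => x _; rewrite ?enum_rankK ?enum_valK.
rewrite (eq_bigr (fun x : cidx r => if x.1 == k then (v ord0 k)@_(x.2)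
  *: 'X_[x.2] else 0)).
  rewrite -(pair_bigA _ (fun k' (m : 'X_{1..n < D}) =>
    if k' == k then (v ord0 k)@_m *: 'X_[m] else 0)) /= (bigD1 k) //=.
  rewrite [X in _ + X]big1 ?addr0.
    by apply: eq_bigr => m _; rewrite eqxx.
  by move=> k' /negbTE k'k; apply: big1 => m _; rewrite k'k.
move=> x _; rewrite !mxE /cval !enum_rankK eqxx /= eq_sym mul_mpolyC.
by case: eqP => [->|_]; rewrite ?mulr1 // mulr0 scaler0.
Qed.

Lemma coords_inj r (v w : 'rV[S]_r) :
  bounded v -> bounded w -> coords v = coords w -> v = w.
Proof. by move=> /coordsK bv /coordsK bw e; rewrite -bv -bw e. Qed.

Lemma subspace_bounded r : subspace (@bounded r).
Proof.
split=> [k|c a b ha hb k]; first by rewrite mxE msize0.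
rewrite !mxE mul_mpolyC; apply: leq_trans (msizeD_le _ _) _.
by rewrite geq_max ha /=; apply: leq_trans (msizeZ_le _ _) _.
Qed.

Lemma bounded_uncoords r (c : 'rV[K]_(cdim r)) : bounded (uncoords c).
Proof.
move=> k; rewrite summxE; apply: leq_trans (msize_sum _ _ _) _.
apply/bigmax_leqP => x _; rewrite !mxE mul_mpolyC.
apply: leq_trans (msizeZ_le _ _) _.
case: (_ && _); last by rewrite mulr0 msize0.
by rewrite mulr1 msizeX bmdeg.
Qed.

Definition diff_mx r r' (A : 'M[S]_(r, r')) : 'M[K]_(cdim r, cdim r') :=
  \matrix_x coords (monvec x *m A).

Lemma diff_mxP r r' (A : 'M[S]_(r, r')) x :
  coords (uncoords x *m A) = x *m diff_mx A.
Proof.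
rewrite /uncoords mulmx_suml; under eq_bigr do rewrite -scalemxAl.
rewrite coords_sum mulmx_sum_row; apply: eq_bigr => y _.
by rewrite rowK.
Qed.

Definition represents r m (A : 'M[K]_(m, cdim r)) (V : set 'rV[S]_r) :=
  forall v, V v <-> bounded v /\ (coords v <= A)%MS.

Lemma is_dim_quot_rank r m m' (A : 'M[K]_(m, cdim r))
    (B : 'M[K]_(m', cdim r)) V W :
  represents A V -> represents B W -> (B <= A)%MS ->
  is_dim_quot V W (\rank A - \rank B).
Proof.
move=> rV rW BA.
have -> : (\rank A - \rank B)%N = \rank (A :\: B).
  have := mxrank_cap_compl A B; rewrite (capmx_idPr BA).1 => <-.
  by rewrite addKn.
set C := row_base (A :\: B)%MS.
have CA : (C <= A)%MS by rewrite eq_row_base diffmxSl.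
exists (fun k => uncoords (row k C)); split.
- move=> k; apply/rV; split; first exact: bounded_uncoords.
  by rewrite uncoordsK; apply: submx_trans (row_sub _ _) CA.
- move=> v /rV[bv vA].
  have : (coords v <= B + C)%MS.
    apply: submx_trans vA _; rewrite -(addsmx_diff_cap_eq A B) addsmxC.
    by rewrite addsmxS // ?capmxSr // eq_row_base.
  move=> /sub_addsmxP[[b c] /= e]; exists (fun k => c ord0 k).
  apply/rW; split.
    apply: subspaceB (subspace_bounded r) bv _;
      apply: subspace_sum (subspace_bounded r) _.
    by move=> k; exact: bounded_uncoords.
  rewrite coordsB coords_sum; under eq_bigr do rewrite uncoordsK.
  by rewrite e -mulmx_sum_row addrK submxMl.
- move=> c /rW[_]; rewrite coords_sum; under eq_bigr do rewrite uncoordsK.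
  pose cc : 'rV_(\rank (A :\: B)) := \row_k c k.
  have -> : \sum_i c i *: row i C = cc *m C.
    by rewrite mulmx_sum_row; apply: eq_bigr => k _; rewrite mxE.
  move=> cB k.
  have : (cc *m C <= B :&: (A :\: B))%MS.
    by rewrite sub_capmx cB /= -(eq_row_base (A :\: B)%MS) submxMl.
  rewrite capmxC capmx_diff submx0 => /eqP ccC.
  have /row_freeP[C' CC'] := row_base_free (A :\: B)%MS.
  have : cc = 0 by rewrite -[cc]mulmx1 -CC' mulmxA ccC mul0mx.
  by move=> /rowP/(_ k); rewrite !mxE.
Qed.

Lemma represents_sub r m m' (A : 'M[K]_(m, cdim r)) (B : 'M[K]_(m', cdim r)) V W :
  represents A V -> represents B W -> W `<=` V -> (B <= A)%MS.
Proof.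
move=> rV rW WV; apply/row_subP => x.
have /WV/rV[_] : W (uncoords (row x B)).
  by apply/rW; rewrite uncoordsK row_sub; split=> //; exact: bounded_uncoords.
by rewrite uncoordsK.
Qed.

Lemma Scomp_bounded d (p : S) : Scomp d p -> d < D%:Z -> (msize p <= D)%N.
Proof.
have [->|p0] := eqVneq p 0; first by rewrite msize0.
by move=> /Scomp_msize/(_ p0); lia.
Qed.

End Coordinates.

(** * Polynomial families with constant dimension *)

Section Families.
Variables (K : fieldType) (n N : nat) (good : set 'rV[K]_N).
Local Notation S := {mpoly K[n]}.
Local Notation cdim D r := #|{: cidx n D r}|.

(* This plays the role of flatness: the degree [d] component of [J u] has
   constant dimension and a basis depending polynomially on [u]. *)
Definition family (J : 'rV[K]_N -> set S) (d : int) :=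
  exists s (f : 'I_s -> 'rV[K]_N -> S),
  [/\ forall l m, regular (fun u => (f l u)@_m),
      forall u, good u -> forall p, (J u p /\ Scomp d p) <->
        exists c : 'I_s -> K, p = \sum_l (c l)%:MP * f l u
    & forall u, good u -> forall c : 'I_s -> K,
        \sum_l (c l)%:MP * f l u = 0 -> forall l, c l = 0].

(** For J = [num N] this is [tens_comp]. It is stated for any set so that it also describes the
    vectors of the same degree with entries in [den N]. *)
Definition comps (J : set S) r (s : 'I_r -> int) (j : int) : set 'rV[S]_r :=
  [set v | forall k, J (v ord0 k) /\ Scomp (j - s k) (v ord0 k)].

Lemma family_comps J r (s : 'I_r -> int) (j : int) D :
  (forall k, family J (j - s k)) -> (forall k, j - s k < D%:Z) ->
  exists a (A : 'rV[K]_N -> 'M[K]_(a, cdim D r)), regular_mx A /\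
    forall u, good u -> row_free (A u) /\ represents (A u) (comps (J u) s j).
Proof.
move=> fJ sD.
have /choice[F FP] : forall k, exists x : {m & 'I_m -> 'rV[K]_N -> S},
  [/\ forall l m, regular (fun u => (tagged x l u)@_m),
      forall u, good u -> forall p, (J u p /\ Scomp (j - s k) p) <->
        exists c : 'I_(tag x) -> K, p = \sum_l (c l)%:MP * tagged x l u
    & forall u, good u -> forall c : 'I_(tag x) -> K,
        \sum_l (c l)%:MP * tagged x l u = 0 -> forall l, c l = 0].
  by move=> k; have [m [f fP]] := fJ k; exists (existT _ m f).
(* The basis length varies with the position, so the joint basis is indexed by a dependent sum. *)
pose T : finType := {k : 'I_r & 'I_(tag (F k))}.
pose vec (x : T) u : 'rV[S]_r := tagged (F (tag x)) (tagged x)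
  u *: delta_mx ord0 (tag x).
pose comb (c : 'I_#|{: T}| -> K) u := \sum_x (c x)%:MP_[n] *: vec (enum_val x) u.
have combE c u k : comb c u ord0 k =
    \sum_l (c (enum_rank (Tagged (fun k => 'I_(tag (F k))) l :
      T)))%:MP * tagged (F k) l u.
  rewrite /comb summxE (reindex (@enum_rank T)) /=; last first.
    by exists enum_val => x _; rewrite ?enum_rankK ?enum_valK.
  under eq_bigr do rewrite enum_rankK.
  pose G k' (l : 'I_(tag (F k'))) := ((c (enum_rank (Tagged (fun k =>
    'I_(tag (F k))) l : T)))%:MP *:
    vec (Tagged (fun k => 'I_(tag (F k))) l) u) ord0 k.
  rewrite (eq_bigr (fun x : T => G (tag x) (tagged x))); last by case.
  rewrite -(sig_big_dep xpredT (fun _ => xpredT) G) /= (bigD1 k) //=.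
  rewrite [X in _ + X]big1 ?addr0.
    by apply: eq_bigr => l _; rewrite /G !mxE !eqxx mulr1.
  move=> k' /negbTE k'k; apply: big1 => l _.
  by rewrite /G !mxE eq_sym k'k andbF mulr0 mulr0.
have bcomps u v : comps (J u) s j v -> bounded D v.
  by move=> h k; have [_ h2] := h k; apply: Scomp_bounded h2 (sD k).
have comb_comps c u : good u -> comps (J u) s j (comb c u).
  move=> gu k; have [_ h _] := FP k; apply/(h u gu).
  by rewrite combE; eexists.
pose A u : 'M[K]_(#|{: T}|, cdim D r) := \matrix_x coords D (vec (enum_val x) u).
have combA c u : (\row_x c x) *m A u = coords D (comb c u).
  rewrite mulmx_sum_row /comb coords_sum; apply: eq_bigr => x _.
  by rewrite rowK mxE.
exists #|{: T}|, A; split.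
  move=> x y; have [h _ _] := FP (tag (enum_val x)).
  have -> : (fun u => A u x y) = (fun u => if (cval y).1 == tag (enum_val x)
      then (tagged (F (tag (enum_val x))) (tagged (enum_val x)) u)@_((cval y).2)
        else 0).
    apply/funext => u; rewrite 4!mxE eqxx /=.
    by case: eqP => _; rewrite ?mulr1 // mulr0 mcoeff0.
  by case: eqP => _; [exact: h|exact: regular_const].
move=> u gu; split.
  rewrite -kermx_eq0; apply/rowV0P => c /sub_kermxP cA.
  have c0 : comb (c ord0) u = 0.
    apply: (@coords_inj _ _ D); first exact: bcomps (comb_comps _ _ gu).
      by case: (subspace_bounded K n D r).
    rewrite coords0 -combA -cA; congr (_ *m _).
    by apply/rowP => x; rewrite mxE.
  apply/rowP => x; rewrite mxE -(enum_valK x).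
  have [_ _ h] := FP (tag (enum_val x)).
  have := h u gu (fun l => c ord0 (enum_rank (Tagged (fun k => 'I_(tag (F k))) l :
    T))).
  by rewrite -combE c0 mxE => /(_ erefl (tagged (enum_val x))); case: (enum_val x).
move=> v; split=> [hv|[bv /submxP[c vc]]].
  split; first exact: bcomps hv.
  have cex : forall k, exists c : 'I_(tag (F k)) -> K,
      v ord0 k = \sum_l (c l)%:MP * tagged (F k) l u.
    by move=> k; have [_ h _] := FP k; apply/(h u gu); exact: hv.
  pose c k := projT1 (cid (cex k)); have cP k := projT2 (cid (cex k)).
  pose c' (x : 'I_#|{: T}|) := c (tag (enum_val x)) (tagged (enum_val x)).
  apply/submxP; exists (\row_x c' x); rewrite combA; congr coords.
  apply/rowP => k; rewrite combE cP; apply: eq_bigr => l _.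
  by rewrite /c' enum_rankK.
rewrite (coords_inj bv _ (_ : coords D v = coords D (comb (c ord0) u))).
- exact: comb_comps.
- exact: bcomps (comb_comps _ _ gu).
- by rewrite -combA vc; congr (_ *m _); apply/rowP => x; rewrite mxE.
Qed.

End Families.

(** * Semicontinuity of the homology dimension *)

Section Semicontinuity.
Variables (K : fieldType) (n : nat).
Local Notation S := {mpoly K[n]}.
Local Notation cdim D r := #|{: cidx n D r}|.

Section Complex.
Variables (M : subquot K n) (F : free_data K n) (hF : graded_free_resolution M F).
Variables (j : int) (D : nat).
Variables (N : nat) (good : set 'rV[K]_N) (Nu : 'rV[K]_N -> subquot K n).
Hypothesis hNu : forall u, good u -> homog_subquot (Nu u).
Hypothesis fnum : forall d, d < D%:Z -> family good (fun u => num (Nu u)) d.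
Hypothesis fden : forall d, d < D%:Z -> family good (fun u => den (Nu u)) d.
Variable u0 : 'rV[K]_N.
Hypothesis gu0 : good u0.

Definition deg_bound i := forall k, j - shift F i k < D%:Z.

Lemma comps_mul (J : set S) i v : ideal J -> comps J (shift F i.+1) j v ->
  comps J (shift F i) j (v *m diff F i).
Proof.
move=> hJ hv k; split; first by apply: ideal_mulmxl => // x; case: (hv x).
have h : homog_mx (fun _ => j) (shift F i.+1) v.
  by move=> x y; rewrite ord1; case: (hv y).
exact: (homog_mxM h (diff_homog hF)).
Qed.

Lemma comps_bounded (J : set S) i v : deg_bound i -> comps J (shift F i) j v ->
  bounded D v.
Proof. by move=> hD hv k; have [_ h] := hv k; apply: Scomp_bounded h (hD k). Qed.

Lemma coords_diff i v : deg_bound i.+1 -> comps setT (shift F i.+1) j v ->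
  coords D (v *m diff F i) = coords D v *m diff_mx D (diff F i).
Proof. by move=> hD hv; rewrite -diff_mxP coordsK //; apply: comps_bounded hv. Qed.

(** Let the rows of [A u] and [B u] be bases of the vectors over [num] in step i and over [den] in
    step i - 1, a and b in number. A cycle is a combination of rows of [A u] whose differential is
    in the row space of [B u], so the cycles have dimension a + b minus the rank of the stacked
    matrix, and near [u0] that rank can only grow. *)
Lemma cycles_rank i : (forall i', (i' <= i)%N -> deg_bound i') ->
  exists a (Z : 'rV[K]_N -> 'M[K]_(a, cdim D (rk F i))),
  (forall u, good u -> represents (Z u) (tens_cycles F (Nu u) i j)) /\
  open_near u0 (fun u => good u -> (\rank (Z u) <= \rank (Z u0))%N).
Proof.
move=> hD.
have [a [A [rA AP]]] := family_comps (fun k => fnum (hD i (leqnn i) k))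
  (hD i (leqnn i)).
case: i hD a A rA AP => [|i] hD a A rA AP.
  exists a, A; split=> [u /AP[] //|].
  exists (fun _ => 1); split; [exact: regular_const|exact: oner_neq0|].
  by move=> u _ gu; have [/eqP -> _] := AP u gu; have [/eqP -> _] := AP u0 gu0.
have [b [B [rB BP]]] := family_comps (fun k => fden (hD i (leqnSn i) k))
  (hD i (leqnSn i)).
pose E := diff_mx D (diff F i).
pose Z u := (A u :&: kermx (E *m cokermx (B u)))%MS.
have ZE u : good u -> (\rank (Z u) + \rank (col_mx (A u *m E) (B u)))%N = (a + b)%N.
  move=> gu; have [/eqP Afree _] := AP u gu; have [/eqP Bfree _] := BP u gu.
  have h1 := mxrank_mul_ker (A u) (E *m cokermx (B u)).
  have h2 := mxrank_mul_ker (col_mx (A u *m E) (B u)) (cokermx (B u)).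
  have h3 : \rank (col_mx (A u *m E) (B u) *m cokermx (B u)) =
            \rank (A u *m (E *m cokermx (B u))).
    by rewrite mul_col_mx mulmx_coker -addsmxE mulmxA addsmx0.
  have h4 : \rank (col_mx (A u *m E) (B u) :&: kermx (cokermx (B u))) = \rank (B u).
    apply: eqmx_rank; apply/andP; split.
      apply/rV_subP => x; rewrite sub_capmx => /andP[_ /sub_kermxP xB].
      by rewrite submxE xB.
    rewrite sub_capmx -addsmxE addsmxSr /=.
    by apply/sub_kermxP; exact: mulmx_coker.
  by rewrite -h2 h3 h4 Bfree addnA [X in (X + _)%N]addnC h1 Afree.
exists _, Z; split=> [u gu v|].
  have [_ AuP] := AP u gu; have [_ BuP] := BP u gu.
  have cT : comps (num (Nu u)) (shift F i.+1) j v -> comps setT (shift F i.+1) j v.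
    by move=> hv k; split=> //; case: (hv k).
  split=> [[cv nv]|[bv]].
    have [bv vA] := (AuP v).1 cv; split=> //.
    rewrite /Z sub_capmx vA /=; apply/sub_kermxP.
    rewrite mulmxA -(coords_diff (hD _ (leqnn _)) (cT cv)).
    have [|_ /submxP[x ->]] := (BuP (v *m diff F i)).1 _.
      by move=> k; split; [exact: nv|have [] := comps_mul (@idealT K n) (cT cv) k].
    by rewrite -mulmxA mulmx_coker mulmx0.
  rewrite /Z sub_capmx => /andP[vA /sub_kermxP].
  have cv : comps (num (Nu u)) (shift F i.+1) j v by apply/AuP.
  rewrite mulmxA -(coords_diff (hD _ (leqnn _)) (cT cv)) => vE; split=> // k.
  suff /(_ k)[] : comps (den (Nu u)) (shift F i) j (v *m diff F i) by [].
  apply/BuP; split; last by rewrite submxE vE.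
  exact: comps_bounded (hD i (leqnSn i)) (comps_mul (@idealT K n) (cT cv)).
have hr : regular_mx (fun u => col_mx (A u *m E) (B u)).
  by apply: regular_col_mx => //; apply: regular_mulmx => //; exact: regular_mx_const.
apply: open_nearS (open_near_rank u0 hr) => u le_rk gu.
by have := ZE u gu; have := ZE u0 gu0; lia.
Qed.

(** Boundaries are taken up to [den], so their space is spanned by the differentials of the vectors
    in step i + 1 together with the vectors over [den] in step i. Its dimension is thus the rank of
    a single regular matrix. *)
Lemma boundaries_rank i : (forall i', (i' <= i.+1)%N -> deg_bound i') ->
  exists a (W : 'rV[K]_N -> 'M[K]_(a, cdim D (rk F i))),
  (forall u, good u -> represents (W u) (tens_boundaries F (Nu u) i j)) /\
  open_near u0 (fun u => (\rank (W u0) <= \rank (W u))%N).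
Proof.
move=> hD; have hDi := hD i (leqnSn i); have hDi1 := hD i.+1 (leqnn i.+1).
have [a [A [rA AP]]] := family_comps (fun k => fnum (hDi1 k)) hDi1.
have [b [B [rB BP]]] := family_comps (fun k => fden (hDi k)) hDi.
pose E := diff_mx D (diff F i).
exists _, (fun u => col_mx (A u *m E) (B u)); split=> [u gu v|]; last first.
  apply: open_near_rank; apply: regular_col_mx => //.
  by apply: regular_mulmx => //; exact: regular_mx_const.
have [_ AuP] := AP u gu; have [_ BuP] := BP u gu.
have [[hn _] [hd _] dn] := hNu gu.
have cT (J : set S) r (s : 'I_r -> int) w : comps J s j w -> comps setT s j w.
  by move=> hw k; split=> //; case: (hw k).
have [c0 cD] := subspace_tens_comp F i j (hNu gu).
split=> [[cv [w cw nw]]|[bv]].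
  split; first exact: comps_bounded hDi cv.
  rewrite -(subrK (w *m diff F i) v) coordsD.
  rewrite -addsmxE; apply: addmx_sub.
    apply: submx_trans (addsmxSr _ _).
    have [|//] := (BuP (v - w *m diff F i)).1 _.
    move=> k; split; first exact: nw.
    rewrite !mxE; apply: ScompB; first by case: (cv k).
    by have [_] := comps_mul (@idealT K n) (cT _ _ _ _ cw) k; rewrite mxE.
  apply: submx_trans (addsmxSl _ _); rewrite coords_diff //; last exact: cT cw.
  by apply: submxMr; have [] := (AuP w).1 cw.
rewrite -addsmxE => /sub_addsmxP[[x y] /= e].
pose w := uncoords (x *m A u).
have cw : comps (num (Nu u)) (shift F i.+1) j w.
  by apply/AuP; rewrite uncoordsK submxMl; split=> //; exact: bounded_uncoords.
pose z := uncoords (y *m B u).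
have cz : comps (den (Nu u)) (shift F i) j z.
  by apply/BuP; rewrite uncoordsK submxMl; split=> //; exact: bounded_uncoords.
have cz' : comps (num (Nu u)) (shift F i) j z.
  by move=> k; have [? ?] := cz k; split=> //; apply: dn.
have cv : comps (num (Nu u)) (shift F i) j (z + w *m diff F i).
  by have := cD 1 _ _ cz' (comps_mul hn cw); rewrite mpolyC1 scale1r.
have vE : v = z + w *m diff F i.
  apply: (@coords_inj _ _ D) => //; first exact: comps_bounded cv.
  by rewrite coordsD coords_diff ?uncoordsK;
    [rewrite e addrC mulmxA|by []|exact: cT cw].
split; first by rewrite vE.
by exists w => //; rewrite vE addrK => k; case: (cz k).
Qed.

End Complex.

Lemma boundaries_sub_cycles M F (N : subquot K n) i j :
  graded_free_resolution M F -> homog_subquot N ->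
  tens_boundaries F N i j `<=` tens_cycles F N i j.
Proof.
move=> hF hN v [cv [w cw nw]]; case: i v cv w cw nw => [|i] // v cv w cw nw.
split=> // k; have -> : v *m diff F i = (v - w *m diff F i.+1) *m diff F i.
  by rewrite mulmxBl -mulmxA (diff_diff _ hF) mulmx0 subr0.
by have [_ [hd _] _] := hN; apply: ideal_mulmxl.
Qed.

Lemma deg_bound_ex (F : free_data K n) j i :
  exists D, forall i', (i' <= i)%N -> deg_bound F j D i'.
Proof.
elim: i => [|i [D hD]].
  exists (\sum_k `|j - shift F 0 k|.+1)%N => i' + k; rewrite leqn0 => /eqP i0;
    subst i'.
  rewrite (bigD1 k) //=; lia.
exists (D + \sum_k `|j - shift F i.+1 k|.+1)%N => i';
  rewrite leq_eqVlt => /orP[/eqP ->|lt] k.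
  rewrite (bigD1 k) //=; lia.
by have := hD i' lt k; lia.
Qed.

(* Choosing [D] first is what allows the family to depend on a weight vector
   which represents a term order only in degrees less than [D]. *)
Theorem tor_semicontinuous M F i j : graded_free_resolution M F ->
  exists D : nat, forall N (good : set 'rV[K]_N) (Nu : 'rV[K]_N -> subquot K n) u0,
  (forall u, good u -> homog_subquot (Nu u)) ->
  (forall d, d < D%:Z -> family good (fun u => num (Nu u)) d) ->
  (forall d, d < D%:Z -> family good (fun u => den (Nu u)) d) ->
  good u0 ->
  exists h : 'rV[K]_N -> nat,
    (forall u, good u ->
      is_dim_quot (tens_cycles F (Nu u) i j) (tens_boundaries F (Nu u) i j) (h u)) /\
    open_near u0 (fun u => good u -> (h u <= h u0)%N).
Proof.
move=> hF; have [D hD] := deg_bound_ex F j i.+1.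
exists D => N good Nu u0 hNu fnum fden gu0.
have hDi i' : (i' <= i)%N -> deg_bound F j D i' by move=> ii'; apply: hD; apply: leqW.
have [a [Z [ZP Zsc]]] := cycles_rank hF fnum fden gu0 hDi.
have [b [W [WP Wsc]]] := boundaries_rank hF hNu fnum fden u0 hD.
exists (fun u => \rank (Z u) - \rank (W u))%N; split=> [u gu|].
  apply: is_dim_quot_rank (ZP u gu) (WP u gu) _.
  apply: represents_sub (ZP u gu) (WP u gu) _.
  exact: boundaries_sub_cycles hF (hNu u gu).
apply: open_nearS (open_nearI Zsc Wsc) => u [hZ hW] gu.
by apply: leq_sub => //; apply: hZ.
Qed.

End Semicontinuity.

(** * Initial ideals *)

Section TermOrders.
Variable n : nat.
Implicit Types (m : 'X_{1..n}) (lt : rel 'X_{1..n}).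

Definition wdeg (wt : 'I_n -> nat) m := (\sum_i m i * wt i)%N.

(* In bounded degree a lexicographic order is the comparison of the values of
   an injective linear form. *)
Definition weighted_order lt := forall D : nat, exists wt : 'I_n -> nat,
  forall m1 m2, (mdeg m1 < D)%N -> (mdeg m2 < D)%N ->
    lt m1 m2 = (wdeg wt m1 < wdeg wt m2)%N /\ (wdeg wt m1 = wdeg wt m2 -> m1 = m2).

Lemma wdegD wt m1 m2 : wdeg wt (m1 + m2)%MM = (wdeg wt m1 + wdeg wt m2)%N.
Proof.
by rewrite /wdeg -big_split /=; apply: eq_bigr => i _; rewrite mnmDE mulnDl.
Qed.

(** The lexicographic order in which a variable counts the more, the larger its [rho]; it treats
    [lex_lt] and [oplex_lt] together. *)
Definition ranked_lt (rho : 'I_n -> nat) : rel 'X_{1..n} := fun m1 m2 =>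
  [exists i : 'I_n,
    (m1 i < m2 i)%N && [forall k : 'I_n, (rho i < rho k)%N ==> (m1 k == m2 k)]].

(** With weights [D ^ rho i] the exponents become digits in base [D], and numbers compare by their
    first differing digit. *)
Lemma ranked_lt_wdeg (rho : 'I_n -> nat) D m1 m2 : injective rho ->
  (mdeg m1 < D)%N -> ranked_lt rho m1 m2 ->
  (wdeg (fun i => D ^ rho i) m1 < wdeg (fun i => D ^ rho i) m2)%N.
Proof.
move=> rho_inj mD /existsP[i /andP[mi /forallP eqk]].
have D0 : (0 < D)%N by apply: leq_ltn_trans mD.
rewrite /wdeg (bigID (fun k => (rho i < rho k)%N)) [X in (_ < X)%N](bigID (fun k =>
  (rho i < rho k)%N)) /=.
rewrite (eq_bigr (fun k => m2 k * D ^ rho k)%N); last first.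
  by move=> k ik; have /implyP/(_ ik)/eqP -> := eqk k.
rewrite ltn_add2l (bigD1 i) ?ltnn //= [X in (_ < X)%N](bigD1 i) ?ltnn //=.
apply: leq_trans (leq_addr _ _).
(* The less significant exponents weigh less than one unit at [i], because the total degree of [m1]
   is below [D]. *)
have low : (\sum_(k | ~~ (rho i < rho k)%N && (k != i))
  m1 k * D ^ rho k < D ^ rho i)%N.
  case ri : (rho i) => [|r].
    rewrite big1 ?expn_gt0 ?D0 // => k /andP[]; rewrite -leqNgt leqn0 => /eqP k0.
    by rewrite (rho_inj k i) ?eqxx // k0 ri.
  apply: leq_ltn_trans (_ : mdeg m1 * D ^ r < _)%N; last first.
    by rewrite expnS ltn_mul2r expn_gt0 D0.
  rewrite mdegE big_distrl /=.
  rewrite [X in (_ <= X)%N](bigID (fun k => ~~ (r.+1 < rho k)%N && (k != i))) /=.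
  apply: leq_trans (leq_addr _ _); apply: leq_sum => k /andP[];
    rewrite -leqNgt => kr ki.
  rewrite leq_mul2l leq_pexp2l ?orbT // -ltnS ltn_neqAle kr andbT.
  by apply: contraNneq ki => e; rewrite (rho_inj k i) // ri.
apply: leq_trans (_ : m1 i * D ^ rho i + D ^ rho i <= _)%N;
  first by rewrite ltn_add2l.
by rewrite -mulSnr leq_mul2r mi orbT.
Qed.

Lemma ranked_lt_total (rho : 'I_n -> nat) m1 m2 : injective rho ->
  m1 <> m2 -> ranked_lt rho m1 m2 \/ ranked_lt rho m2 m1.
Proof.
move=> rho_inj ne.
have [i0 ne0] : exists i, m1 i != m2 i.
  apply/existsP; apply: contra_notT ne => /existsPn eqm.
  by apply/mnmP => i; apply/eqP; rewrite -[_ == _]negbK.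
case: (@arg_maxnP _ i0 (fun i => m1 i != m2 i) rho ne0) => i nei imax.
have eqk k : (rho i < rho k)%N -> m1 k == m2 k.
  by move=> ik; apply: contraLR ik => /imax; rewrite -leqNgt.
case: (ltngtP (m1 i) (m2 i)) nei => // lti _; [left|right]; apply/existsP; exists i.
  by rewrite lti; apply/forallP => k; apply/implyP => /eqk.
by rewrite lti; apply/forallP => k; apply/implyP => /eqk; rewrite eq_sym.
Qed.

Lemma ranked_lt_weighted rho : injective rho -> weighted_order (ranked_lt rho).
Proof.
move=> rho_inj D; exists (fun i => D ^ rho i)%N => m1 m2 m1D m2D.
have lt12 := @ranked_lt_wdeg rho D m1 m2 rho_inj m1D.
have lt21 := @ranked_lt_wdeg rho D m2 m1 rho_inj m2D.
have [e|ne] := eqVneq m1 m2.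
  subst m2; rewrite ltnn; split=> //.
  by case h: (ranked_lt rho m1 m1) => //; have := lt12 h; rewrite ltnn.
have [h|h] := ranked_lt_total rho_inj (elimN eqP ne).
  by have := lt12 h; rewrite h => l; rewrite l; split=> // e; rewrite e ltnn in l.
have l := lt21 h; split; last by move=> e; rewrite e ltnn in l.
rewrite [RHS]ltnNge ltnW //=.
by case h': (ranked_lt rho m1 m2) => //; have := lt12 h'; rewrite ltnNge ltnW.
Qed.

Lemma oplex_weighted : weighted_order (@oplex_lt n).
Proof. exact: (ranked_lt_weighted (rho := val) val_inj). Qed.

Lemma lex_weighted : weighted_order (@lex_lt n).
Proof.
have -> : @lex_lt n = ranked_lt (fun i : 'I_n => rev_ord i).
  apply/funext => m1; apply/funext => m2; apply: eq_existsb => i; congr (_ && _).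
  apply: eq_forallb => k; congr (_ ==> _) => /=.
  by have := ltn_ord i; have := ltn_ord k; lia.
by apply: ranked_lt_weighted => i k /val_inj/rev_ord_inj.
Qed.

End TermOrders.

(** * Initial monomials and bases of graded components *)

Section Groebner.
Variables (K : fieldType) (n : nat) (lt : rel 'X_{1..n}).
Hypothesis hlt : weighted_order lt.
Local Notation S := {mpoly K[n]}.
Implicit Types (I : set S) (p : S) (m : 'X_{1..n}).

Definition inits I : set 'X_{1..n} := [set m | exists2 p, I p & is_init_mon lt p m].

(** Compatibility with multiplication follows from the additivity of weights, for a weight vector
    valid up to the degrees of both products. *)
Lemma lt_add m m1 m2 : lt m1 m2 -> lt (m + m1)%MM (m + m2)%MM.
Proof.
have [wt wtP] := hlt (mdeg m + (mdeg m1 + mdeg m2)).+1.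
have [||-> _] := wtP m1 m2; try lia.
have [||-> _] := wtP (m + m1)%MM (m + m2)%MM; rewrite ?mdegD; try lia.
by rewrite !wdegD ltn_add2l.
Qed.

Lemma inits_add I m m' : ideal I -> inits I m -> inits I (m' + m)%MM.
Proof.
move=> [_ _ IM] [p Ip [mp ltm]]; exists ('X_[m'] * p); first exact: IM.
have suppE k : (k \in msupp ('X_[m'] * p)) = (k \in [seq (m' + x)%MM | x <- msupp p]).
  by rewrite mulrC (perm_mem (msuppMX p m')).
split; first by rewrite suppE; apply/mapP; exists m.
move=> k; rewrite suppE => /mapP[k' k'p ->] ne; apply: lt_add; apply: ltm => //.
by apply: contraNneq ne => ->.
Qed.

Lemma init_idealE I : ideal I ->
  init_ideal lt I = [set p | forall m, m \in msupp p -> inits I m].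
Proof.
move=> hI; apply/seteqP; split=> p.
  apply; split; last first.
    by move=> _ [m Im <-] m' /=; rewrite msuppX inE => /eqP ->.
  split=> [m|q1 q2 h1 h2 m|a q h m].
  - by rewrite msupp0.
  - by move=> /msuppD_le; rewrite mem_cat => /orP[/h1|/h2].
  - move=> /msuppM_le/allpairsP[[m1 m2] /= [_ m2q ->]]; apply: inits_add => //.
    exact: h.
move=> /= hp; rewrite (mpolyE p) => J [hJ XJ].
rewrite big_seq; apply: ideal_sum => // m mp.
have [_ _ JM] := hJ; rewrite -mul_mpolyC; apply: JM; apply: XJ.
by exists m => //; exact: hp.
Qed.

Lemma init_ideal_homog I : ideal I -> homog_ideal (init_ideal lt I).
Proof.
move=> hI; apply: homog_ideal_hcomp => [|p d].
  split=> [J [[]] //|p q hp hq J hJ|a p hp J hJ]; have [[_ JD JM] _] := hJ.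
    by apply: JD; [exact: hp|exact: hq].
  by apply: JM; exact: hp.
rewrite init_idealE //= => hp m; rewrite mcoeff_msupp mcoeff_hcomp.
by case: ifP => _; rewrite ?eqxx // -mcoeff_msupp; exact: hp.
Qed.

Definition monic_init m p :=
  p@_m = 1 /\ forall m', p@_m' != 0 -> m' != m -> lt m' m.

Lemma init_monic I m : homog_ideal I -> inits I m ->
  exists p, [/\ I p, Scomp (mdeg m)%:Z p & monic_init m p].
Proof.
move=> hI [p Ip [mp ltm]]; have pm : p@_m != 0 by rewrite -mcoeff_msupp.
exists ((p@_m)^-1%:MP * hcomp (mdeg m)%:Z p); split.
- by have [[_ _ IM] _] := hI; apply: IM; exact: homog_hcomp.
- by apply: ScompCM; exact: hcomp_Scomp.
- split=> [|m']; rewrite mcoeffCM mcoeff_hcomp ?eqxx ?mulVf //.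
  rewrite mulf_eq0 negb_or => /andP[_]; case: ifP => [_|_]; last by rewrite eqxx.
  by rewrite -mcoeff_msupp => mp' ne; apply: ltm.
Qed.

Lemma init_mon_ex (k : nat) p : Scomp k%:Z p -> p != 0 -> exists m,
  is_init_mon lt p m.
Proof.
move=> /ScompP hp p0; have [wt wtP] := hlt k.+1.
have lp := mlead_supp p0.
have li : (index (mlead p) (msupp p) < size (msupp p))%N by rewrite index_mem.
pose mon (x : 'I_(size (msupp p))) := nth 0%MM (msupp p) x.
case: (@arg_maxnP _ (Ordinal li) predT (fun x => wdeg wt (mon x)) isT) => x _ xmax.
have xs : mon x \in msupp p by exact: mem_nth.
have deg m : m \in msupp p -> (mdeg m < k.+1)%N.
  by rewrite mcoeff_msupp => /hp [] ->.
exists (mon x); split=> // m' m'p ne.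
have [-> inj] := wtP m' (mon x) (deg _ m'p) (deg _ xs).
rewrite ltn_neqAle; apply/andP; split.
  by apply: contraNneq ne => /inj ->.
have li' : (index m' (msupp p) < size (msupp p))%N by rewrite index_mem.
by have := xmax (Ordinal li') isT; rewrite /mon /= nth_index.
Qed.

(** Among the indices with nonzero coefficient take the one whose initial monomial is heaviest: no
    other summand contains that monomial. *)
Lemma triangular_free (k : nat) s (mon : 'I_s -> 'X_{1..n}) (f : 'I_s -> S) :
  injective mon -> (forall l, mdeg (mon l) = k) ->
  (forall l, monic_init (mon l) (f l)) ->
  forall c : 'I_s -> K, \sum_l (c l)%:MP * f l = 0 -> forall l, c l = 0.
Proof.
move=> mon_inj degm fm c sum0 l; apply/eqP/negPn/negP => cl.
have [wt wtP] := hlt k.+1.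
case: (@arg_maxnP _ l (fun l => c l != 0) (fun l => wdeg wt (mon l)) cl)
  => l1 cl1 l1max.
have /mpolyP/(_ (mon l1)) := sum0.
rewrite raddf_sum mcoeff0 (bigD1 l1) //= mcoeffCM (fm l1).1 mulr1 big1 ?addr0.
  by move/eqP; rewrite (negbTE cl1).
move=> l2 ne; rewrite mcoeffCM.
have [->|f2] := eqVneq (f l2)@_(mon l1) 0; first by rewrite mulr0.
have [->|cl2] := eqVneq (c l2) 0; first by rewrite mul0r.
have ne' : mon l1 != mon l2 by apply: contraNneq ne => /mon_inj ->.
have := (fm l2).2 _ f2 ne'.
have [||-> _] := wtP (mon l1) (mon l2); rewrite ?degm //.
by rewrite ltnNge; have /= -> := l1max l2 cl2.
Qed.

(** Works in one degree: with [triangular_free] the [f l] are a K-basis of I_k, indexed by the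
    initial monomials of degree k. Spanning is proved by reduction. *)
Theorem groebner_basis I (k : nat) : homog_ideal I ->
  exists s (mon : 'I_s -> 'X_{1..n}) (f : 'I_s -> S),
  [/\ injective mon,
      forall m, (inits I m /\ mdeg m = k) <-> exists l, m = mon l,
      forall l, [/\ I (f l), Scomp k%:Z (f l) & monic_init (mon l) (f l)]
    & forall p, I p -> Scomp k%:Z p -> exists c : 'I_s -> K, p =
      \sum_l (c l)%:MP * f l].
Proof.
move=> hI.
pose P m := (mdeg m == k) && `[< inits I m >].
pose B := [seq m <- [seq val x | x : 'X_{1..n < k.+1}] | P m].
have Bu : uniq B by rewrite filter_uniq // map_inj_uniq ?enum_uniq //; exact: val_inj.
have BP m : (m \in B) <-> inits I m /\ mdeg m = k.
  rewrite mem_filter; split=> [/andP[/andP[/eqP dm /asboolP im] _] //|[im dm]].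
  rewrite /P dm eqxx asboolT //=; have dmk : (mdeg m < k.+1)%N by rewrite dm.
  by apply/mapP; exists (BMultinom dmk); rewrite ?mem_enum.
pose mon (l : 'I_(size B)) := nth 0%MM B l.
have monB l : mon l \in B by exact: mem_nth.
have /choice[f fP] : forall l, exists p, [/\ I p, Scomp k%:Z p & monic_init (mon l)
  p].
  move=> l; have [im dm] := (BP _).1 (monB l).
  by rewrite -dm; exact: init_monic.
exists (size B), mon, f; split=> //.
- move=> l1 l2 e; apply: val_inj; apply/eqP.
  by rewrite -(nth_uniq 0%MM (ltn_ord l1) (ltn_ord l2) Bu); apply/eqP.
- move=> m; split=> [/BP mB|[l ->]]; last by apply/BP.
  have mi : (index m B < size B)%N by rewrite index_mem.
  by exists (Ordinal mi); rewrite /mon nth_index.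
have [wt wtP] := hlt k.+1.
have deg p m : Scomp k%:Z p -> p@_m != 0 -> (mdeg m < k.+1)%N.
  by move=> /ScompP h /h [] ->.
(* [N] strictly bounds the weights of the monomials of [p]; cancelling the initial term lowers this
   bound. *)
suff H N p : I p -> Scomp k%:Z p -> (forall m, p@_m != 0 -> (wdeg wt m < N)%N) ->
    exists c : 'I_(size B) -> K, p = \sum_l (c l)%:MP * f l.
  move=> p Ip hp; apply: (H (\max_(m <- msupp p) wdeg wt m).+1) => // m pm.
  by rewrite ltnS (big_rem m) ?mcoeff_msupp //= leq_maxl.
elim: N p => [|N IHN] p Ip hp pN.
  exists (fun _ => 0); rewrite big1 => [|l _]; last by rewrite mpolyC0 mul0r.
  by apply/mpolyP => m; rewrite mcoeff0; apply/eqP/negPn/negP => /pN.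
have [p0|p0] := eqVneq p 0.
  exists (fun _ => 0); rewrite big1 // => l _; by rewrite mpolyC0 mul0r.
have [m [mp ltm]] := init_mon_ex hp p0.
have pm : p@_m != 0 by rewrite -mcoeff_msupp.
have mB : m \in B.
  apply/BP; split; first by exists p.
  by have /ScompP/(_ _ pm)[] := hp.
have mi : (index m B < size B)%N by rewrite index_mem.
pose l0 := Ordinal mi; have monl0 : mon l0 = m by rewrite /mon nth_index.
have [If hf [f1 flt]] := fP l0; rewrite monl0 in f1 flt.
have [|||c cP] := IHN (p - (p@_m)%:MP * f l0).
- by have [h _] := hI; apply: idealB => //; have [_ _ IM] := h; apply: IM.
- by apply: ScompB => //; apply: ScompCM.
- move=> m' ; rewrite mcoeffB mcoeffCM.
  have [->|ne] := eqVneq m' m; first by rewrite f1 mulr1 subrr eqxx.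
  move=> nz; have ltm' : lt m' m.
    have [pm'0|pm'] := eqVneq p@_m' 0.
      apply: flt => //; apply: contraNneq nz => ->.
      by rewrite pm'0 mulr0 subrr.
    by apply: ltm => //; rewrite mcoeff_msupp.
  have dm' : (mdeg m' < k.+1)%N.
    apply: (deg (p - (p@_m)%:MP * f l0)); first by apply: ScompB => //;
      apply: ScompCM.
    by rewrite mcoeffB mcoeffCM.
  move: ltm'; have [//||-> _] := wtP m' m; first exact: deg pm.
  by move=> /leq_trans; apply; rewrite -ltnS; exact: pN.
exists (fun l => c l + (l == l0)%:R * p@_m).
under eq_bigr do rewrite mpolyCD mulrDl.
rewrite big_split /= -cP (bigD1 l0) //= eqxx mul1r big1 ?addr0 ?subrK //
  => l /negbTE ->.
by rewrite mul0r mpolyC0 mul0r.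
Qed.

End Groebner.

(** * Coordinate changes *)

Section CoordChange.
Variables (K : fieldType) (n : nat).
Local Notation S := {mpoly K[n]}.
Implicit Types (g h : 'M[K]_n) (p q : S) (I : set S).

Definition linear_images g := [tuple \sum_(j < n) g j i *: 'X_j | i < n] : n.-tuple S.

HB.instance Definition _ g :=
  GRing.RMorphism.copy (coord_change g) (comp_mpoly (linear_images g)).

Lemma coord_changeC g (c : K) : coord_change g c%:MP = c%:MP.
Proof. exact: comp_mpolyC. Qed.

Lemma coord_changeZ g (c : K) p : coord_change g (c%:MP * p)
  = c%:MP * coord_change g p.
Proof. by rewrite rmorphM /= coord_changeC. Qed.

Lemma coord_changeXm g m :
  coord_change g 'X_[m] = \prod_(i < n) (\sum_(j < n) g j i *: 'X_j) ^+ m i.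
Proof.
by rewrite /coord_change comp_mpolyX; apply: eq_bigr => i _; rewrite tnth_mktuple.
Qed.

Lemma coord_changeE g p :
  coord_change g p = \sum_(m <- msupp p) (p@_m)%:MP * coord_change g 'X_[m].
Proof.
by rewrite /coord_change comp_mpolyEX; apply: eq_bigr => m _; rewrite mul_mpolyC.
Qed.

Lemma coord_change1 p : coord_change 1%:M p = p.
Proof.
rewrite -[RHS]comp_mpoly_id /coord_change; congr (_ \mPo _).
apply: eq_from_tnth => i; rewrite !tnth_mktuple (bigD1 i) //= mxE eqxx scale1r.
by rewrite big1 ?addr0 // => j /negbTE ji; rewrite mxE ji scale0r.
Qed.

Lemma coord_change_comp g h p :
  coord_change g (coord_change h p) = coord_change (g *m h) p.
Proof.
rewrite (coord_changeE h) (coord_changeE (g *m h)) rmorph_sum /=.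
apply: eq_bigr => m _; rewrite coord_changeZ; congr (_ * _).
rewrite !coord_changeXm rmorph_prod /=; apply: eq_bigr => i _.
rewrite rmorphXn rmorph_sum /=; congr (_ ^+ _).
under eq_bigr => j _.
  rewrite -mul_mpolyC coord_changeZ.
  have -> : coord_change g 'X_j = \sum_k g k j *: 'X_k.
    by rewrite /coord_change comp_mpolyXU -tnth_nth tnth_mktuple.
  rewrite mulr_sumr; over.
rewrite exchange_big; apply: eq_bigr => k _ /=.
under eq_bigr do rewrite mul_mpolyC scalerA mulrC.
by rewrite -scaler_suml mxE.
Qed.

Lemma coord_changeK g : g \in unitmx -> cancel (coord_change g)
  (coord_change (invmx g)).
Proof. by move=> gu p; rewrite coord_change_comp mulVmx // coord_change1. Qed.

Lemma coord_changeVK g : g \in unitmx -> cancel (coord_change (invmx g))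
  (coord_change g).
Proof. by move=> gu p; rewrite coord_change_comp mulmxV // coord_change1. Qed.

Lemma Scomp_prod (I : Type) (r : seq I) (d : I -> nat) (F : I -> S) :
  (forall i, Scomp (d i)%:Z (F i)) -> Scomp (\sum_(i <- r)
    d i)%N%:Z (\prod_(i <- r) F i).
Proof.
move=> hF; elim: r => [|i r IHr]; first by rewrite !big_nil; exact: (ScompC n 1).
by rewrite !big_cons PoszD; apply: ScompM.
Qed.

Lemma Scomp_exp1 p k : Scomp 1 p -> Scomp k%:Z (p ^+ k).
Proof.
move=> hp; elim: k => [|k IHk]; first exact: (ScompC n 1).
by rewrite exprS -add1n PoszD; apply: ScompM.
Qed.

Lemma coord_change_Scomp g d p : Scomp d p -> Scomp d (coord_change g p).
Proof.
move=> /ScompP hp; rewrite coord_changeE big_seq.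
apply: Scomp_sum => m; rewrite mcoeff_msupp => /hp <-; apply: ScompCM.
rewrite coord_changeXm mdegE; apply: Scomp_prod => i; apply: Scomp_exp1.
apply: Scomp_sum => j _; rewrite -mul_mpolyC; apply: ScompCM.
by rewrite -[1](congr1 Posz (mdeg1 j)); apply: ScompX.
Qed.

Lemma hcomp_ne d e p : Scomp e p -> e != d -> hcomp d p = 0.
Proof.
move=> /ScompP hp ne; apply/mpolyP => m; rewrite mcoeff_hcomp mcoeff0.
case: eqP => // dm; apply/eqP/negPn/negP => /hp e1.
by move: ne; rewrite -e1 dm eqxx.
Qed.

Lemma hcomp_coord_change g d p : hcomp d (coord_change g p)
  = coord_change g (hcomp d p).
Proof.
have {1 2}-> := sum_hcomp p.
rewrite (hcomp_sum d _ _ (fun k : 'I__ => hcomp (k : nat)%:Z p)) !rmorph_sum /=.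
rewrite hcomp_sum; apply: eq_bigr => k _.
have hk := hcomp_Scomp (k : nat)%:Z p; have [e|ne] := eqVneq (k : nat)%:Z d.
  by rewrite -e !hcomp_id //; exact: coord_change_Scomp.
by rewrite !(hcomp_ne _ ne) ?rmorph0 //; exact: coord_change_Scomp.
Qed.

Lemma coord_change_imageE g I p : g \in unitmx ->
  (coord_change g @` I) p <-> I (coord_change (invmx g) p).
Proof.
move=> gu; split=> [[q Iq <-]|Ip]; first by rewrite coord_changeK.
by exists (coord_change (invmx g) p) => //; rewrite coord_changeVK.
Qed.

Lemma coord_change_image_mem g I p : g \in unitmx ->
  (coord_change g @` I) (coord_change g p) <-> I p.
Proof. by move=> gu; rewrite coord_change_imageE // coord_changeK. Qed.

Lemma coord_change_image_comp g h I :
  coord_change g @` (coord_change h @` I) = coord_change (g *m h) @` I.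
Proof.
apply/seteqP; split=> [_ [_ [p Ip <-] <-]|_ [p Ip <-]].
  by exists p => //; rewrite coord_change_comp.
by exists (coord_change h p); [exists p|rewrite coord_change_comp].
Qed.

Lemma coord_change_imageV g I : g \in unitmx ->
  coord_change (invmx g) @` (coord_change g @` I) = I.
Proof.
move=> gu; rewrite coord_change_image_comp mulVmx //.
apply/seteqP; split=> [_ [p Ip <-]|p Ip]; first by rewrite coord_change1.
by exists p => //; rewrite coord_change1.
Qed.

Lemma coord_change_homog g I : g \in unitmx -> homog_ideal I ->
  homog_ideal (coord_change g @` I).
Proof.
move=> gu hI; have [[I0 ID IM] _] := hI; apply: homog_ideal_hcomp.
  split=> [|_ _ [p Ip <-] [q Iq <-]|a _ [p Ip <-]].
  - by exists 0 => //; rewrite rmorph0.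
  - by exists (p + q); [exact: ID|rewrite rmorphD].
  - exists (coord_change (invmx g) a * p); first exact: IM.
    by rewrite rmorphM /= coord_changeVK.
move=> _ d [p Ip <-]; rewrite hcomp_coord_change.
by exists (hcomp d p) => //; exact: homog_hcomp.
Qed.

Definition change_subquot g (M : subquot K n) :=
  Subquot (coord_change g @` num M) (coord_change g @` den M).

Definition change_free g (F : free_data K n) :=
  @FreeData K n (rk F) (shift F) (fun i => map_mx (coord_change g) (diff F i))
    (map_mx (coord_change g) (aug F)).

Lemma change_quot_mod g I : g \in unitmx ->
  change_subquot g (quot_mod I) = quot_mod (coord_change g @` I).
Proof.
move=> gu; congr Subquot; apply/seteqP; split=> // p _.
by apply/coord_change_imageE.
Qed.

Lemma change_ideal_mod g I : change_subquot g (ideal_mod I)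
  = ideal_mod (coord_change g @` I).
Proof.
congr Subquot; apply/seteqP; split=> [_ [_ -> <-]|_ ->];
  first by rewrite /mkset rmorph0.
by exists 0; rewrite ?rmorph0.
Qed.

Lemma map_coord_changeVK g a b (A : 'M[S]_(a, b)) : g \in unitmx ->
  map_mx (coord_change g) (map_mx (coord_change (invmx g)) A) = A.
Proof. by move=> gu; apply/matrixP => x y; rewrite !mxE coord_changeVK. Qed.

Lemma map_coord_change_inj g a b : g \in unitmx ->
  injective (map_mx (coord_change g) : 'M[S]_(a, b) -> 'M[S]_(a, b)).
Proof.
move=> gu A B /matrixP e; apply/matrixP => x y; have := e x y; rewrite !mxE.
by move/(can_inj (coord_changeK gu)).
Qed.

Lemma change_resolution g M F : g \in unitmx -> graded_free_resolution M F ->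
  graded_free_resolution (change_subquot g M) (change_free g F).
Proof.
move=> gu [h1 [h2 [h3 [h4 h5]]]].
split; [|split; [|split; [|split]]].
- move=> k /=; rewrite mxE; have [a1 a2] := h1 k.
  by split; [exists (aug F k ord0)|exact: coord_change_Scomp].
- by move=> i a b /=; rewrite mxE; apply: coord_change_Scomp; exact: h2.
- move=> _ [p np <-]; have [v dv] := h3 p np; exists (map_mx (coord_change g) v).
  by rewrite -map_mxM mxE /= -rmorphB; eexists; first exact: dv.
- move=> v /=; rewrite -[v](map_coord_changeVK _ gu) -map_mxM mxE /=.
  rewrite [X in X <-> _](coord_change_image_mem (den M) _ gu) h4;
    split=> [[w ->]|[w e]].
    by exists (map_mx (coord_change g) w); rewrite -map_mxM.
  exists (map_mx (coord_change (invmx g)) w); apply: (map_coord_change_inj gu).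
  by rewrite map_mxM /= [map_mx _ (map_mx _ w)](map_coord_changeVK _ gu) e.
- move=> i v /=; rewrite -[v](map_coord_changeVK _ gu) -map_mxM.
  rewrite -[X in _ = X <-> _](map_mx0 (coord_change g));
    split=> [/(map_coord_change_inj gu)/h5[w ->]|[w e]].
    by exists (map_mx (coord_change g) w); rewrite -map_mxM.
  congr map_mx; apply/h5.
  exists (map_mx (coord_change (invmx g)) w); apply: (map_coord_change_inj gu).
  by rewrite map_mxM /= [map_mx _ (map_mx _ w)](map_coord_changeVK _ gu) e.
Qed.

Lemma change_tens_comp g F N i j v : g \in unitmx ->
  tens_comp (change_free g F) (change_subquot g N) i j (map_mx (coord_change g) v) <->
  tens_comp F N i j v.
Proof.
move=> gu; split=> h k; have [h1 h2] := h k; rewrite !mxE in h1 h2 *; split.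
- by apply/(coord_change_image_mem _ _ gu).
- by rewrite -(coord_changeK gu (v _ _)); exact: coord_change_Scomp.
- by apply/(coord_change_image_mem _ _ gu).
- exact: coord_change_Scomp.
Qed.

Lemma change_tens_null g N r (v : 'rV[S]_r) : g \in unitmx ->
  tens_null (change_subquot g N) (map_mx (coord_change g) v) <-> tens_null N v.
Proof.
by move=> gu; split=> h k; have := h k; rewrite mxE;
  have e := coord_change_image_mem (den N) (v ord0 k) gu; move/e.
Qed.

(** [coord_change g] is not S-linear, but it is K-linear and respects products, which is enough for
    its graph to serve in [is_dim_quot_rel]. *)
Theorem change_is_dim_quot g F N i j d : g \in unitmx ->
  homog_subquot N -> homog_subquot (change_subquot g N) ->
  is_dim_quot (tens_cycles F N i j) (tens_boundaries F N i j) d ->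
  is_dim_quot (tens_cycles (change_free g F) (change_subquot g N) i j)
    (tens_boundaries (change_free g F) (change_subquot g N) i j) d.
Proof.
move=> gu hN hgN.
have cycE v : tens_cycles (change_free g F) (change_subquot g N)
  i j (map_mx (coord_change g) v) <->
    tens_cycles F N i j v.
  case: i v => [|i] v; first exact: change_tens_comp.
  rewrite /tens_cycles /mkset /= -map_mxM.
  by rewrite (change_tens_comp N j v gu) (change_tens_null N _ gu).
apply: (is_dim_quot_rel (R := fun v v' => v' = map_mx (coord_change g) v)).
- by rewrite map_mx0.
- move=> c a b a' b' -> ->; apply/rowP => k.
  by rewrite !mxE rmorphD /= coord_changeZ.
- exact: subspace_tens_cycles.
- exact: subspace_tens_cycles.
- by move=> v cv; exists (map_mx (coord_change g) v) => //; apply/cycE.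
- move=> v cv; exists (map_mx (coord_change (invmx g)) v);
  last by rewrite map_coord_changeVK.
  by apply/cycE; rewrite map_coord_changeVK.
- move=> v _ -> _ _; split=> [[cv [w cw nw]]|[cv [w cw nw]]].
    split; first by apply/change_tens_comp.
    exists (map_mx (coord_change g) w); first by apply/(change_tens_comp N j w gu).
    by rewrite -map_mxM -map_mxB; apply/change_tens_null.
  split; first by apply/(change_tens_comp N j v gu).
  rewrite -[w](map_coord_changeVK _ gu) in cw nw.
  exists (map_mx (coord_change (invmx g)) w);
    first by apply/(change_tens_comp N j _ gu).
  by rewrite -map_mxM -map_mxB in nw; apply/(change_tens_null N _ gu).
Qed.

End CoordChange.

(** * Polynomial families of ideals *)

Section FamiliesOfIdeals.
Variables (K : fieldType) (n : nat).
Local Notation S := {mpoly K[n]}.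

Definition regular_poly N (F : 'rV[K]_N -> S) := forall m, regular (fun u =>
  (F u)@_m).

Lemma regular_poly_const N p : regular_poly (fun _ : 'rV[K]_N => p).
Proof. by move=> m; exact: regular_const. Qed.

Lemma regular_polyM N (F G : 'rV[K]_N -> S) :
  regular_poly F -> regular_poly G -> regular_poly (fun u => F u * G u).
Proof.
move=> hF hG m; under eq_fun do rewrite mcoeffM.
by apply: regular_sum => k _; apply: regularM.
Qed.

Lemma regular_poly_sum N (I : Type) (r : seq I) (F : I -> 'rV[K]_N -> S) :
  (forall i, regular_poly (F i)) -> regular_poly (fun u => \sum_(i <- r) F i u).
Proof.
move=> hF m; under eq_fun do rewrite raddf_sum /=.
by apply: regular_sum => k _; apply: hF.
Qed.

Lemma regular_poly_prod N (I : Type) (r : seq I) (F : I -> 'rV[K]_N -> S) :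
  (forall i, regular_poly (F i)) -> regular_poly (fun u => \prod_(i <- r) F i u).
Proof.
move=> hF; elim: r => [|i r IHr].
  by under eq_fun do rewrite big_nil; exact: regular_poly_const.
by under eq_fun do rewrite big_cons; exact: regular_polyM.
Qed.

Lemma regular_polyX N (F : 'rV[K]_N -> S) k :
  regular_poly F -> regular_poly (fun u => F u ^+ k).
Proof.
move=> hF; elim: k => [|k IHk]; first exact: regular_poly_const.
by under eq_fun do rewrite exprS; exact: regular_polyM.
Qed.

Lemma regular_poly_coord_change p :
  regular_poly (fun u : 'rV[K]_(n * n) => coord_change (vec_mx u) p).
Proof.
under eq_fun do rewrite coord_changeE.
apply: regular_poly_sum => m; apply: regular_polyM; first exact: regular_poly_const.
under eq_fun do rewrite coord_changeXm.
apply: regular_poly_prod => i; apply: regular_polyX; apply: regular_poly_sum => j.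
move=> m'; under eq_fun do rewrite mcoeffZ mxE.
by apply: regularM; [exact: regular_coord|exact: regular_const].
Qed.

Lemma family_neg N (good : set 'rV[K]_N) (J : 'rV[K]_N -> set S) k :
  (forall u, good u -> J u 0) -> family good J (Negz k).
Proof.
move=> J0; exists 0%N, (fun _ _ => 0); split=> [[]//|u gu p|u gu c _ []//].
rewrite /= /mkset; split=> [[_ ->]|[c ->]]; last by rewrite big_ord0; split=> //;
  apply: J0.
by exists (fun _ => 0); rewrite big_ord0.
Qed.

(** The images of a fixed K-basis of J_d depend polynomially on the entries of g; [groebner_basis]
    only supplies that basis. *)
Lemma family_change (good : set 'rV[K]_(n * n)) (J : set S) d :
  homog_ideal J -> (forall u, good u -> vec_mx u \in unitmx) ->
  family good (fun u => coord_change (vec_mx u) @` J) d.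
Proof.
move=> hJ gunit; have [[J0 JD JM] _] := hJ.
case: d => k; last first.
  by apply: family_neg => u _; exists 0 => //; rewrite rmorph0.
have [s [mon [f [mon_inj monP fP span]]]] := groebner_basis (@oplex_weighted n) k hJ.
have degmon l : mdeg (mon l) = k by have [] := (monP (mon l)).2 (ex_intro _ l erefl).
exists s, (fun l u => coord_change (vec_mx u) (f l)); split.
- by move=> l; exact: regular_poly_coord_change.
- move=> u gu p; have uu := gunit u gu; split=> [[[q Jq <-] hq]|[c ->]].
    have [|c ->] := span q Jq.
      by rewrite -(coord_changeK uu q); exact: coord_change_Scomp.
    exists c; rewrite rmorph_sum; apply: eq_bigr => l _; exact: coord_changeZ.
  rewrite (eq_bigr (fun l => coord_change (vec_mx u) ((c l)%:MP * f l))); last first.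
    by move=> l _; rewrite coord_changeZ.
  rewrite -rmorph_sum; split.
    exists (\sum_l (c l)%:MP * f l) => //; apply: ideal_sum => // l _.
    by apply: JM; case: (fP l).
  apply: coord_change_Scomp; apply: Scomp_sum => l _; apply: ScompCM.
  by case: (fP l).
- move=> u gu c e; have uu := gunit u gu.
  apply: (triangular_free (@oplex_weighted n) mon_inj degmon (f := f)).
    by move=> l; case: (fP l).
  apply: (can_inj (coord_changeK uu)); rewrite rmorph0 -[RHS]e rmorph_sum.
  by apply: eq_bigr => l _; exact: coord_changeZ.
Qed.

(** The basis comes from [family_change] restricted to the single point g = 1. *)
Lemma family_const N (good : set 'rV[K]_N) (J : set S) d :
  homog_ideal J -> family good (fun _ => J) d.
Proof.
move=> hJ; have [|s [f [_ fJ ind]]] := @family_change [set mxvec 1%:M] J d hJ.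
  by move=> u ->; rewrite mxvecK unitmx1.
have J1 : coord_change (vec_mx (mxvec 1%:M)) @` J = J.
  rewrite mxvecK; apply/seteqP; split=> [_ [p Jp <-]|p Jp];
    first by rewrite coord_change1.
  by exists p => //; rewrite coord_change1.
exists s, (fun l _ => f l (mxvec 1%:M)); split.
- by move=> l m; exact: regular_const.
- by move=> u _ p; have := fJ (mxvec 1%:M) erefl p; rewrite J1.
- by move=> u _; exact: (ind (mxvec 1%:M) erefl).
Qed.

(** * Degeneration to the initial ideal by a torus *)

Section Torus.
Variables (lt : rel 'X_{1..n}) (hlt : weighted_order lt).

(** Inverse powers of t, so that after multiplication by t to the weight of the initial monomial the
    remaining terms carry positive powers of t and vanish at t = 0. *)
Definition torus (wt : 'I_n -> nat) (t : K) : 'M[K]_n :=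
  diag_mx (\row_i t^-1 ^+ wt i).

Lemma torus_unit wt t : t != 0 -> torus wt t \in unitmx.
Proof.
move=> t0; rewrite unitmxE det_diag unitfE; apply/prodf_neq0 => i _.
by rewrite mxE expf_neq0 ?invr_eq0.
Qed.

Lemma torusX wt t m :
  coord_change (torus wt t) 'X_[m] = (t^-1 ^+ wdeg wt m)%:MP * 'X_[m].
Proof.
rewrite coord_changeXm mpolyXE_id /wdeg.
have -> : (t^-1 ^+ (\sum_i m i * wt i))%:MP_[n] =
  \prod_i ((t^-1 ^+ wt i)%:MP ^+ m i : S).
  rewrite -prodrXr rmorph_prod /=; apply: eq_bigr => i _.
  by rewrite mulnC exprM rmorphXn.
rewrite -big_split /=; apply: eq_bigr => i _; rewrite -exprMn; congr (_ ^+ _).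
rewrite (bigD1 i) //= !mxE eqxx mulr1n mul_mpolyC big1 ?addr0 // => j /negbTE ji.
by rewrite !mxE ji mulr0n scale0r.
Qed.

Lemma mcoeff_torus wt t p m :
  (coord_change (torus wt t) p)@_m = p@_m * t^-1 ^+ wdeg wt m.
Proof.
rewrite coord_changeE raddf_sum /=;
  under eq_bigr do rewrite torusX mulrA -mpolyCM mcoeffCM mcoeffX.
have [mp|mp] := boolP (m \in msupp p).
  rewrite (bigD1_seq m) ?msupp_uniq //= eqxx mulr1 big1 ?addr0 // => m' /negbTE ->.
  by rewrite mulr0.
rewrite (memN_msupp_eq0 mp) mul0r big1_seq // => m' /= mp'.
by case: eqP => [e|]; [rewrite -e mp' in mp|rewrite mulr0].
Qed.

(** Flatness of the Groebner degeneration, including the fibre at 0: the rescaled basis elements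
    [F l] have coefficients polynomial in t and keep their initial monomials. *)
Lemma family_torus (wt : 'I_n -> nat) (D : nat) (J : set S) d :
  (forall m1 m2, (mdeg m1 < D)%N -> (mdeg m2 < D)%N ->
    lt m1 m2 = (wdeg wt m1 < wdeg wt m2)%N /\ (wdeg wt m1 = wdeg wt m2 -> m1 = m2)) ->
  homog_ideal J -> d < D%:Z ->
  family setT (fun u : 'rV[K]_1 => if u ord0 ord0 == 0 then init_ideal lt J
    else coord_change (torus wt (u ord0 ord0)) @` J) d.
Proof.
move=> wtP hJ dD; have [[J0 JD JM] _] := hJ.
case: d dD => k kD; last first.
  apply: family_neg => u _; case: eqP => _; last by exists 0 => //; rewrite rmorph0.
  by have [[]] := init_ideal_homog hlt (proj1 hJ).
have [s [mon [f [mon_inj monP fP span]]]] := groebner_basis hlt k hJ.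
have degmon l : mdeg (mon l) = k by have [] := (monP (mon l)).2 (ex_intro _ l erefl).
have kD' : (k < D)%N by lia.
pose F l (u : 'rV[K]_1) : S := \sum_(m <- msupp (f l))
  ((f l)@_m * u ord0 ord0 ^+ (wdeg wt (mon l) - wdeg wt m))%:MP * 'X_[m].
have FE l u m : (F l u)@_m = (f l)@_m * u ord0 ord0 ^+ (wdeg wt (mon l) - wdeg wt m).
  rewrite /F raddf_sum /=; under eq_bigr do rewrite mcoeffCM mcoeffX.
  have [mp|mp] := boolP (m \in msupp (f l)).
    rewrite (bigD1_seq m) ?msupp_uniq //= eqxx mulr1 big1 ?addr0 // => m' /negbTE ->.
    by rewrite mulr0.
  rewrite (memN_msupp_eq0 mp) mul0r big1_seq // => m' /= mp'.
  by case: eqP => [e|]; [rewrite -e mp' in mp|rewrite mulr0].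
have flt l m : (f l)@_m != 0 -> m != mon l -> (wdeg wt m < wdeg wt (mon l))%N.
  move=> fm ne; have [_ /ScompP hf [_ mlt]] := fP l.
  have := mlt m fm ne; have [||-> //] := wtP m (mon l); last by rewrite degmon.
  by have [->] := hf m fm.
(* The initial monomial does not depend on [u], so [triangular_free] gives independence at all
   parameters, t = 0 included. *)
have Fmonic l u : monic_init lt (mon l) (F l u).
  have [_ _ [f1 mlt]] := fP l; split; first by rewrite FE f1 subnn mulr1.
  move=> m; rewrite FE mulf_eq0 negb_or => /andP[fm _]; exact: mlt.
have F0 l (u : 'rV[K]_1) : u ord0 ord0 = 0 -> F l u = 'X_[mon l].
  move=> u0; apply/mpolyP => m; rewrite FE u0 mcoeffX.
  have [_ _ [f1 _]] := fP l.
  have [->|ne] := eqVneq m (mon l); first by rewrite f1 subnn mulr1.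
  have [->|fm] := eqVneq (f l)@_m 0; first by rewrite mul0r.
  by rewrite expr0n subn_eq0 leqNgt (flt l m fm ne) mulr0.
have Ft l (u : 'rV[K]_1) : u ord0 ord0 != 0 ->
    F l u = (u ord0 ord0 ^+ wdeg wt (mon l))%:MP * coord_change (torus wt (u ord0 ord0)) (f l).
  move=> u0; apply/mpolyP => m; rewrite FE mcoeffCM mcoeff_torus.
  have [->|fm] := eqVneq (f l)@_m 0; first by rewrite !mul0r mulr0.
  rewrite mulrCA; congr (_ * _); rewrite exprVn expfB_cond // (negbTE u0) add0n.
  have [->|ne] := eqVneq m (mon l); first by rewrite leqnn.
  by rewrite (ltnW (flt l m fm ne)).
exists s, F; split.
- move=> l m; under eq_fun do rewrite FE.
  by apply: regularM; [exact: regular_const|apply: regularX; exact: regular_coord].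
- move=> u _ p; have [u0|u0] := eqVneq (u ord0 ord0) 0.
    under [X in _ <-> X]eq_exists => c do under eq_bigr do rewrite (F0 _ _ u0).
    have hI := proj1 hJ; rewrite (init_idealE hlt hI).
    split=> [[pin hp]|[c ->]].
      exists (fun l => p@_(mon l)); apply/mpolyP => m.
      rewrite raddf_sum /=; under eq_bigr do rewrite mcoeffCM mcoeffX.
      have [/eqP pm|pm] := boolP (p@_m == 0).
        rewrite pm big1 // => l _; case: eqP => [->|_]; last by rewrite mulr0.
        by rewrite pm mul0r.
      have [l ml] : exists l, m = mon l.
        apply/monP; split; first by apply: pin; rewrite mcoeff_msupp.
        by have /ScompP/(_ _ pm)[] := hp.
      rewrite (bigD1 l) //= -ml eqxx mulr1 big1 ?addr0 // => l' /negbTE nl.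
      by case: eqP => [e|]; [move: nl;
        rewrite -(inj_eq mon_inj) e ml eqxx|rewrite mulr0].
    split.
      move=> m /=; rewrite mcoeff_msupp raddf_sum /= => nz.
      have [l ml] : exists l, m = mon l.
        apply: contrapT => nl; move: nz; rewrite big1 ?eqxx // => l _.
        rewrite mcoeffCM mcoeffX; case: eqP => [e|]; last by rewrite mulr0.
        by case: nl; exists l.
      by have [] := (monP m).2 (ex_intro _ l ml).
    by apply: Scomp_sum => l _; apply: ScompCM; rewrite -(degmon l); exact: ScompX.
  have tu := torus_unit wt u0.
  set t := u ord0 ord0 in u0 tu Ft *.
  split=> [[[q Jq <-] hq]|[c ->]].
    have [|c ->] := span q Jq.
      by rewrite -(coord_changeK tu q); exact: coord_change_Scomp.
    exists (fun l => c l * t ^- wdeg wt (mon l)); rewrite rmorph_sum;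
      apply: eq_bigr => l _.
    rewrite Ft // -/t mulrA -mpolyCM mulfVK ?expf_neq0 //; exact: coord_changeZ.
  rewrite (eq_bigr (fun l => coord_change (torus wt t)
    ((c l * t ^+ wdeg wt (mon l))%:MP * f l))); last first.
    by move=> l _; rewrite coord_changeZ Ft // -/t mulrA -mpolyCM.
  rewrite -rmorph_sum; split.
    exists (\sum_l (c l * t ^+ wdeg wt (mon l))%:MP * f l) => //;
      apply: ideal_sum => // l _.
    by apply: JM; case: (fP l).
  apply: coord_change_Scomp; apply: Scomp_sum => l _; apply: ScompCM.
  by case: (fP l).
- move=> u _; apply: (triangular_free hlt mon_inj degmon) => l; exact: Fmonic.
Qed.

End Torus.
End FamiliesOfIdeals.

(** * Existence of generic initial ideals *)

Section Generic.
Variables (K : fieldType) (hK : infinite_set [set: K]).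

(** The parameters range over all of affine space; invertibility is imposed by intersecting with
    [generic_unit]. *)
Definition generic N (P : 'rV[K]_N -> Prop) := exists u0, open_near u0 P.

Lemma genericS N (P Q : 'rV[K]_N -> Prop) : (forall u, P u -> Q u) ->
  generic P -> generic Q.
Proof. by move=> PQ [u0 h]; exists u0; exact: open_nearS PQ h. Qed.

Lemma genericI N (P Q : 'rV[K]_N -> Prop) : generic P -> generic Q ->
  generic (fun u => P u /\ Q u).
Proof.
move=> [u [f [rf f0 fP]]] [v [g [rg g0 gQ]]].
have [w [fw gw]] := regular_nonvanishing2 hK rf rg f0 g0.
by exists w; apply: open_nearI; [exists f|exists g].
Qed.

Lemma generic_lt N B (P : nat -> 'rV[K]_N -> Prop) :
  (forall i, (i < B)%N -> generic (P i)) -> generic (fun u => forall i,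
    (i < B)%N -> P i u).
Proof.
elim: B => [|B IHB] h.
  by exists 0, (fun _ => 1); split; [exact: regular_const|exact: oner_neq0|].
have h1 := IHB (fun i iB => h i (ltnW iB)).
apply: genericS (genericI h1 (h B (ltnSn B))) => u [P1 P2] i.
by rewrite ltnS leq_eqVlt => /orP[/eqP ->|/P1].
Qed.

Lemma generic_ex N (P : 'rV[K]_N -> Prop) : generic P -> exists u, P u.
Proof. by move=> [u [f [_ f0 fP]]]; exists u; exact: fP. Qed.

Variable n : nat.

Lemma regular_det_vec : regular (fun u : 'rV[K]_(n * n) => \det (vec_mx u)).
Proof.
by apply: regular_det => x y; under eq_fun do rewrite mxE; exact: regular_coord.
Qed.

Lemma generic_unit : generic (fun u : 'rV[K]_(n * n) => vec_mx u \in unitmx).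
Proof.
exists (mxvec 1%:M), (fun u => \det (vec_mx u)); split.
- exact: regular_det_vec.
- by rewrite mxvecK det1 oner_neq0.
- by move=> u; rewrite unitmxE unitfE.
Qed.

Lemma for_general_generic (P : 'M[K]_n -> Prop) :
  generic (fun u => vec_mx u \in unitmx -> P (vec_mx u)) -> for_general P.
Proof.
move=> gP; have [u [f [[p fp] f0 fP]]] := genericI gP generic_unit.
exists [set g | g \in unitmx /\ exists2 q, q = p & q.@[fun k => mxvec g ord0 k] != 0].
split; first by exists [set p].
- exists (vec_mx u); have [_ uu] := fP u f0; split=> //.
  by exists p => //; rewrite vec_mxK -fp.
- move=> g [gu [_ -> pg]]; rewrite -(mxvecK g).
  by have [|h _] := fP (mxvec g); [rewrite fp|apply: h; rewrite mxvecK].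
Qed.

Lemma for_general_ex (P : 'M[K]_n -> Prop) : for_general P ->
  exists2 g, g \in unitmx & P g.
Proof.
by move=> [U [[Q ->] [g gU] UP]]; exists g; [case: gU|exact: UP].
Qed.

End Generic.

Section GinExists.
Variables (K : fieldType) (hK : infinite_set [set: K]) (n : nat).
Variables (lt : rel 'X_{1..n}) (hlt : weighted_order lt).
Local Notation S := {mpoly K[n]}.
Variables (I : set S) (hI : homog_ideal I).
Local Notation gI u := (coord_change (vec_mx u) @` I).

(* Given the initial monomials larger than m, the monomial m is initial in
   degree k iff the rank of the coefficient matrix jumps when the column of m
   is added to those of the larger monomials; and ranks are generically
   maximal. *)
Lemma generic_inits k : exists G : set 'X_{1..n}, generic (fun u =>
  vec_mx u \in unitmx /\ forall m, mdeg m = k -> (inits lt (gI u) m <-> G m)).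
Proof.
have [s [mon [f [mon_inj monP fP span]]]] := groebner_basis hlt k hI.
have [wt wtP] := hlt k.+1.
pose T : finType := 'X_{1..n < k.+1}.
pose tval (x : 'I_#|{: T}|) : 'X_{1..n < k.+1} := enum_val x.
(* [A N] keeps the columns of weight at least [N]. Weights are injective in degree at most k, so
   passing from [N.+1] to [N] with N the weight of [m] frees exactly the column of [m]. *)
pose A N u : 'M[K]_(s, #|{: T}|) := \matrix_(l, x)
  if (N <= wdeg wt (tval x))%N then (coord_change (vec_mx u) (f l))@_(tval x) else 0.
pose comb (c : 'rV[K]_s) u := \sum_l (c ord0 l)%:MP * coord_change (vec_mx u) (f l).
have cA c N u x : (c *m A N u) ord0 x =
    if (N <= wdeg wt (tval x))%N then (comb c u)@_(tval x) else 0.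
  rewrite mxE; under eq_bigr do rewrite mxE.
  case: ifP => _; last by rewrite big1 // => l _; rewrite mulr0.
  by rewrite raddf_sum; apply: eq_bigr => l _; rewrite /= mcoeffCM.
have rA N : regular_mx (A N).
  move=> l x; under eq_fun do rewrite mxE.
  by case: (boolP (N <= _)%N) => _;
    [exact: regular_poly_coord_change|exact: regular_const].
clearbody A.
have comb_hom c u : Scomp k%:Z (comb c u).
  apply: Scomp_sum => l _; apply: ScompCM; apply: coord_change_Scomp.
  by case: (fP l).
have comb_in c u : gI u (comb c u).
  exists (\sum_l (c ord0 l)%:MP * f l).
    have [[_ _ IM] _] := hI.
    by apply: ideal_sum => [|l _]; [case: hI|apply: IM; case: (fP l)].
  by rewrite rmorph_sum; apply: eq_bigr => l _; exact: coord_changeZ.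
have in_comb u p : gI u p -> Scomp k%:Z p -> vec_mx u \in unitmx -> exists c, p =
  comb c u.
  move=> [q Iq <-] hq uu; have [|c ->] := span q Iq.
    by rewrite -(coord_changeK uu q); exact: coord_change_Scomp.
  exists (\row_l c l); rewrite rmorph_sum; apply: eq_bigr => l _.
  by rewrite mxE; exact: coord_changeZ.
have monT m : (mdeg m < k.+1)%N -> exists x, m = tval x.
  by move=> mk; exists (enum_rank (BMultinom mk : T)); rewrite /tval enum_rankK.
have deg_supp c u m : (comb c u)@_m != 0 -> (mdeg m < k.+1)%N.
  by have /ScompP h := comb_hom c u; move=> /h[->].
have ker_sub N u : (kermx (A N u) <= kermx (A N.+1 u))%MS.
  apply/rV_subP => c /sub_kermxP/rowP c0; apply/sub_kermxP/rowP => x.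
  have := c0 x; rewrite !cA !mxE; case: ifP => [_ ->|Nw _]; first by rewrite if_same.
  by case: ifP => // /ltnW; rewrite Nw.
have initsE u m : vec_mx u \in unitmx -> mdeg m = k ->
    inits lt (gI u) m <-> \rank (A (wdeg wt m).+1 u) <> \rank (A (wdeg wt m) u).
  move=> uu dm; set N := wdeg wt m;
    have [x0 mx0] := monT m (eq_leq (congr1 succn dm)).
  (* A rank jump means that some element of the kernel for [N.+1] leaves the kernel for [N]: a
     combination with no monomial heavier than [m] in which [m] occurs, so that [m] is initial. *)
  have rank_kerE : \rank (A N.+1 u) = \rank (A N u) <->
      (kermx (A N.+1 u) <= kermx (A N u))%MS.
    have [le_ker eq_ker] := mxrank_leqif_sup (ker_sub N u).
    rewrite -eq_ker !mxrank_ker.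
    have := rank_leq_row (A N u); have := rank_leq_row (A N.+1 u).
    split=> [->//|/eqP]; lia.
  split=> [im /rank_kerE sub|ne].
    have [p [Ip hp [pm plt]]] := init_monic (coord_change_homog uu hI) im.
    rewrite dm in hp; have [c pc] := in_comb u p Ip hp uu.
    have : (c <= kermx (A N.+1 u))%MS.
      apply/sub_kermxP/rowP => x; rewrite cA mxE; case: ifP => // Nx.
      apply/eqP/negPn/negP; rewrite -pc => px.
      have xm : bmnm (tval x) != m by apply: contraTneq Nx => ->; rewrite ltnn.
      have := plt _ px xm; have [||-> _] := wtP (tval x) m; rewrite ?bmdeg ?dm //.
      by rewrite ltnNge ltnW.
    move=> /submx_trans/(_ sub)/sub_kermxP/rowP/(_ x0).
    by rewrite cA mxE -mx0 leqnn -pc pm => /eqP; rewrite oner_eq0.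
  have /row_subPn[r cN] : ~~ (kermx (A N.+1 u) <= kermx (A N u))%MS.
    by apply/negP => /rank_kerE.
  set c := row r _ in cN.
  have cN1 : c *m A N.+1 u = 0 by apply/sub_kermxP; exact: row_sub.
  have high m' : (comb c u)@_m' != 0 -> (wdeg wt m' <= N)%N.
    move=> nz; have [x ex] := monT m' (deg_supp _ _ _ nz).
    rewrite leqNgt; apply/negP => Nm'; move: cN1 => /rowP/(_ x).
    by rewrite cA mxE -ex Nm' => e; rewrite e eqxx in nz.
  have [x cx] : exists x, (c *m A N u) ord0 x != 0.
    apply/existsP; apply: contraR cN => /existsPn c0; apply/sub_kermxP/rowP => x.
    by rewrite [RHS]mxE; apply/eqP; rewrite -[_ == _]negbK; exact: c0.
  move: cx; rewrite cA; case: ifP => [Nx cx|_]; last by rewrite eqxx.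
  have wx : wdeg wt (tval x) = N by apply/eqP; rewrite eqn_leq Nx high.
  have xm : bmnm (tval x) = m.
    by have [||_ inj] := wtP (tval x) m; rewrite ?bmdeg ?dm //; apply: inj.
  exists (comb c u) => //; split; first by rewrite mcoeff_msupp -xm.
  move=> m'; rewrite mcoeff_msupp => nz ne'.
  have [||-> inj] := wtP m' m; rewrite ?dm ?(deg_supp _ _ _ nz) //.
  by rewrite ltn_neqAle high // andbT; apply: contraNneq ne' => /inj ->.
have /choice[U UP] : forall N, exists u0, vec_mx u0 \in unitmx /\
    forall u, vec_mx u \in unitmx -> (\rank (A N u) <= \rank (A N u0))%N.
  move=> N; have ex : exists r, `[< exists2 u0,
    vec_mx u0 \in unitmx & \rank (A N u0) = r >].
    by eexists; apply/asboolP; exists (mxvec 1%:M); rewrite ?mxvecK ?unitmx1.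
  have ub r : `[< exists2 u0, vec_mx u0 \in unitmx & \rank (A N u0) = r >] ->
    (r <= s)%N.
    by move=> /asboolP[u0 _ <-]; exact: rank_leq_row.
  case: (ex_maxnP ex ub) => r /asboolP[u0 uu0 <-] rmax; exists u0; split=> // u uu.
  by apply: rmax; apply/asboolP; exists u.
exists [set m | \rank (A (wdeg wt m).+1 (U (wdeg wt m).+1)) <> \rank (A (wdeg wt m)
  (U (wdeg wt m)))].
(* [.+2] because the criterion also involves the index [(wdeg wt m).+1], which has to stay below
   [B]. *)
pose B := (\max_(x : T) wdeg wt x).+2.
have gB : generic (fun u => forall N, (N < B)%N -> (\rank (A N (U N))
  <= \rank (A N u))%N).
  by apply: (generic_lt hK) => N _; exists (U N); exact: open_near_rank.
apply: genericS (genericI hK gB (generic_unit K n)) => u [rmax uu]; split=> // m dm.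
have wB : (wdeg wt m < B.-1)%N.
  have mk : (mdeg m < k.+1)%N by rewrite dm.
  by rewrite /B /= ltnS (bigD1 (BMultinom mk : T)) //= leq_maxl.
have rE N : (N < B)%N -> \rank (A N u) = \rank (A N (U N)).
  by move=> NB; apply/eqP; rewrite eqn_leq rmax // (UP N).2.
rewrite (initsE u m uu dm) !rE //; exact: ltnW.
Qed.

(** Genericity is imposed only in the degrees of Dickson generators of [G]. This puts [G] inside the
    initial monomials of g(I) in every degree; the reverse inclusion is a count, since coordinate
    changes preserve the dimensions of graded components. *)
Theorem gin_exists : exists G, is_gin lt I G.
Proof.
have /choice[Gd GdP] := generic_inits.
pose G : set 'X_{1..n} := [set m | Gd (mdeg m) m].
have G_add m m' : G m -> G (m' + m)%MM.
  (* At one [u] generic for both degrees, [G] agrees in them with the initial monomials of an actual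
     ideal. *)
  move=> Gm; have [u [[uu h1] [_ h2]]] :=
    generic_ex (genericI hK (GdP (mdeg m)) (GdP (mdeg (m' + m)%MM))).
  apply/(h2 _ erefl); apply: (inits_add hlt).
    by case: (coord_change_homog uu hI).
  by apply/h1.
have [B [BG GB]] := dickson G.
pose D := (\max_(m <- B) mdeg m).+1.
exists [set p | forall m, m \in msupp p -> G m]; apply: (for_general_generic hK).
apply: genericS (generic_lt hK (B := D) (fun k _ => GdP k)) => u uP uu.
have hgI := coord_change_homog uu hI.
rewrite (init_idealE hlt (proj1 hgI)).
suff initsG m : inits lt (gI u) m <-> G m.
  by apply/seteqP; split=> p h m /h /initsG.
have sub m' : G m' -> inits lt (gI u) m'.
  move=> /GB[g gB gm]; rewrite -(submK gm); apply: (inits_add hlt);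
    first by case: hgI.
  have gD : (mdeg g < D)%N by rewrite /D ltnS (big_rem g) //= leq_maxl.
  by have [_ h] := uP _ gD; apply/h => //; exact: BG.
split; last exact: sub.
move=> im; have [u' [uu' u'P]] := generic_ex (GdP (mdeg m)).
have hgI' := coord_change_homog uu' hI.
have [s [mon [f [mon_inj monP fP span]]]] := groebner_basis hlt (mdeg m) hgI.
have [s' [mon' [f' [mon'_inj mon'P f'P span']]]] := groebner_basis hlt (mdeg m) hgI'.
have degmon l : mdeg (mon l) = mdeg m by have [] :=
  (monP (mon l)).2 (ex_intro _ l erefl).
have monG l' : G (mon' l').
  by have [i' d'] := (mon'P (mon' l')).2 (ex_intro _ l' erefl);
    rewrite /G /mkset d'; apply/u'P.
have /choice[sg sgP] : forall l', exists l, mon' l' = mon l.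
  move=> l'; apply/monP; split; first exact: sub.
  by have [] := (mon'P (mon' l')).2 (ex_intro _ l' erefl).
have sg_inj : injective sg.
  by move=> a b e; apply: mon'_inj; rewrite !sgP e.
(* The coordinate change [h] carries the ideal at [u] to the one at [u'], so [s] independent
   elements map to independent elements of a space spanned by [s']. *)
have ss' : (s <= s')%N.
  pose h := vec_mx u' *m invmx (vec_mx u).
  have hu : h \in unitmx by rewrite unitmx_mul uu' unitmx_inv.
  have /choice[C CP] : forall l, exists c : 'I_s' -> K,
      coord_change h (f l) = \sum_x (c x)%:MP * f' x.
    move=> l; have [[p Ip pf] hf _] := fP l; apply: span';
      last exact: coord_change_Scomp.
    by exists p => //; rewrite -pf coord_change_comp mulmxKV.
  suff : row_free (\matrix_(l, x) C l x) by move=> /eqP <-; exact: rank_leq_col.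
  rewrite -kermx_eq0; apply/rowV0P => c /sub_kermxP/rowP cC; apply/rowP => l;
    rewrite mxE.
  apply: (triangular_free hlt mon_inj degmon (f := f)).
    by move=> l0; case: (fP l0).
  apply: (can_inj (coord_changeK hu)); rewrite rmorph0 rmorph_sum /=.
  under eq_bigr => l0 _ do rewrite coord_changeZ CP mulr_sumr.
  rewrite exchange_big big1 //= => x _.
  under eq_bigr do rewrite mulrA -mpolyCM.
  rewrite -mulr_suml -rmorph_sum /=.
  have -> : \sum_l0 c ord0 l0 * C l0 x = 0.
    transitivity ((c *m (\matrix_(l, x) C l x)) ord0 x); last by rewrite cC mxE.
    by rewrite mxE; apply: eq_bigr => l0 _; rewrite mxE.
  by rewrite mpolyC0 mul0r.
have [l ml] : exists l, m = mon l by apply/monP.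
have /codomP[l' ll'] : l \in codom sg.
  by apply: inj_card_onto => //; rewrite !card_ord.
by rewrite ml ll' -sgP.
Qed.

End GinExists.

(** * Comparison of Tor dimensions *)

Section TorDimension.
Variables (K : fieldType) (n : nat).
Local Notation S := {mpoly K[n]}.
Implicit Types (M N : subquot K n).

Lemma is_dim_Tor_res M N F i j d : homog_subquot M -> homog_subquot N ->
  graded_free_resolution M F -> is_dim_Tor M N i j d ->
  is_dim_quot (tens_cycles F N i j) (tens_boundaries F N i j) d.
Proof.
move=> hM hN hF [F' hF' dF']; have [Q hQ _] := resolution_exists hN.
have dQ := tor_balance hM hN hF' hQ dF'.
exact: tor_balance hN hM hQ hF dQ.
Qed.

(** Finite dimensionality is read off [tor_semicontinuous] for a constant family. *)
Lemma is_dim_Tor_ex M N i j : homog_subquot M -> homog_subquot N ->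
  exists d, is_dim_Tor M N i j d.
Proof.
move=> hM hN; have [F hF _] := resolution_exists hM.
have [hn hd _] := hN.
have [D /(_ 1%N setT (fun _ => N) 0)[]//] := tor_semicontinuous i j hF.
- by move=> d _; exact: family_const.
- by move=> d _; exact: family_const.
by move=> h [hP _]; exists (h 0), F => //; apply: hP.
Qed.

Lemma dim_TorP M N i j : homog_subquot M -> homog_subquot N ->
  is_dim_Tor M N i j (dim_Tor M N i j).
Proof. move=> hM hN.
exact: (@xgetPex _ 0%N [set d | is_dim_Tor M N i j d] (is_dim_Tor_ex i j hM hN)). Qed.

Lemma dim_Tor_res M N F i j d : homog_subquot M -> homog_subquot N ->
  graded_free_resolution M F ->
  is_dim_quot (tens_cycles F N i j) (tens_boundaries F N i j) d ->
  dim_Tor M N i j = d.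
Proof.
move=> hM hN hF; apply: is_dim_quot_uniq; first exact: subspace_tens_boundaries.
exact: is_dim_Tor_res hM hN hF (dim_TorP i j hM hN).
Qed.

Lemma dim_TorC M N i j : homog_subquot M -> homog_subquot N ->
  dim_Tor M N i j = dim_Tor N M i j.
Proof.
move=> hM hN; have [F hF dF] := dim_TorP i j hM hN.
have [Q hQ _] := resolution_exists hN.
by rewrite (dim_Tor_res hN hM hQ (tor_balance hM hN hF hQ dF)).
Qed.

Lemma dim_Tor_change g M N i j : g \in unitmx -> homog_subquot M -> homog_subquot N ->
  dim_Tor (change_subquot g M) (change_subquot g N) i j = dim_Tor M N i j.
Proof.
move=> gu hM hN.
have change_homog N' : homog_subquot N' -> homog_subquot (change_subquot g N').
  move=> [hn hd dn]; split; [exact: coord_change_homog|exact: coord_change_homog|].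
  by move=> _ [p dp <-]; exists p => //; exact: dn.
have [F hF dF] := dim_TorP i j hM hN.
apply: dim_Tor_res (change_resolution gu hF) _; try exact: change_homog.
exact: change_is_dim_quot gu hN (change_homog N hN) dF.
Qed.

(** In this range every shift of F_i exceeds j, so the entries of a cycle have negative degree. *)
Lemma dim_Tor_eq0 M N i (j : int) : homog_subquot M -> homog_subquot N ->
  (`|j|.+1 < i)%N -> dim_Tor M N i j = 0%N.
Proof.
move=> hM hN ji; have [F hF shF] := resolution_exists hM.
apply: (dim_Tor_res hM hN hF); case: i ji => // i ji.
have cyc0 v : tens_cycles F N i.+1 j v -> v = 0.
  move=> [cv _]; apply/rowP => k; rewrite mxE; have [_] := cv k.
  by apply: Scomp_lt0; have := shF i k; lia.
exists (fun _ => 0); split=> [[]//|v /cyc0 ->|c _ []//].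
exists (fun _ => 0); rewrite big_ord0 subr0.
by have [h _] := subspace_tens_boundaries F i.+1 j hN.
Qed.

Lemma dim_Tor_semicontinuous M i j : homog_subquot M ->
  exists D : nat, forall (N : nat) (good : set 'rV[K]_N) (Nu : 'rV[K]_N ->
    subquot K n) u0,
  (forall u, good u -> homog_subquot (Nu u)) ->
  (forall d, d < D%:Z -> family good (fun u => num (Nu u)) d) ->
  (forall d, d < D%:Z -> family good (fun u => den (Nu u)) d) ->
  good u0 ->
  open_near u0 (fun u => good u -> (dim_Tor M (Nu u) i j <= dim_Tor M (Nu u0) i j)%N).
Proof.
move=> hM; have [F hF _] := resolution_exists hM.
have [D hD] := tor_semicontinuous i j hF.
exists D => N good Nu u0 hNu fnum fden gu0.
have [h [hP hsc]] := hD N good Nu u0 hNu fnum fden gu0.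
have hE u : good u -> dim_Tor M (Nu u) i j = h u.
  by move=> gu; apply: (dim_Tor_res hM (hNu u gu) hF); exact: hP.
by apply: open_nearS hsc => u hu gu; rewrite !hE //; exact: hu.
Qed.

End TorDimension.

(** * The two degenerations and the passage to general g *)

Section Comparison.
Variables (K : fieldType) (hK : infinite_set [set: K]) (n : nat).
Local Notation S := {mpoly K[n]}.
Implicit Types (I J : set S) (b : bool).

(* S / I or I, so that both parts of the theorem are treated at once. *)
Definition ideal_or_quot b I := if b then quot_mod I else ideal_mod I.

Lemma homog_ideal_or_quot b I : homog_ideal I -> homog_subquot (ideal_or_quot b I).
Proof. by case: b; [exact: homog_quot_mod|exact: homog_ideal_mod]. Qed.

Lemma change_ideal_or_quot b g I : g \in unitmx ->
  change_subquot g (ideal_or_quot b I) = ideal_or_quot b (coord_change g @` I).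
Proof. by move=> gu; case: b; [exact: change_quot_mod|exact: change_ideal_mod]. Qed.

Lemma family_ideal_or_quot b N (good : set 'rV[K]_N) (J : 'rV[K]_N -> set S) d :
  family good J d ->
  family good (fun u => num (ideal_or_quot b (J u))) d /\
  family good (fun u => den (ideal_or_quot b (J u))) d.
Proof.
case: b => fJ; split=> //=.
  exact: (family_const good d (@homog_idealT K n)).
exact: (family_const good d (@homog_ideal0 K n)).
Qed.

(** Semicontinuity at t = 0 gives the inequality where [f] is nonzero, and [regular_nonvanishing2]
    finds such a parameter that is itself nonzero. The bound [D] depends on [M] alone, so the
    weights can be chosen after it. *)
Lemma torus_degeneration lt b M J i j : weighted_order lt -> homog_subquot M ->
  homog_ideal J -> exists2 g, g \in unitmx &
  (dim_Tor M (ideal_or_quot b (coord_change g @` J)) i j <=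
   dim_Tor M (ideal_or_quot b (init_ideal lt J)) i j)%N.
Proof.
move=> hlt hM hJ; have [D hD] := dim_Tor_semicontinuous i j hM.
have [wt wtP] := hlt D.
pose Ju (u : 'rV[K]_1) := if u ord0 ord0 == 0 then init_ideal lt J
  else coord_change (torus wt (u ord0 ord0)) @` J.
have Ju_homog u : homog_ideal (Ju u).
  rewrite /Ju; case: ifPn => u0; first exact: (init_ideal_homog hlt (proj1 hJ)).
  exact: (coord_change_homog (torus_unit wt u0) hJ).
have fam d : d < D%:Z -> family setT Ju d by exact: family_torus.
have Ju0 : Ju 0 = init_ideal lt J by rewrite /Ju mxE eqxx.
have [||||f [rf f0 fP]] := hD 1%N setT (fun u => ideal_or_quot b (Ju u)) 0.
- by move=> u _; exact: homog_ideal_or_quot.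
- by move=> d /fam/(family_ideal_or_quot b)[].
- by move=> d /fam/(family_ideal_or_quot b)[].
- by [].
have c1 : (const_mx 1 : 'rV[K]_1) ord0 ord0 != 0 by rewrite mxE oner_neq0.
have [u [fu u0]] := regular_nonvanishing2 hK rf (@regular_coord K 1 ord0) f0 c1.
exists (torus wt (u ord0 ord0)); first exact: torus_unit.
by have := fP u fu I; rewrite Ju0 {1}/Ju (negbTE u0).
Qed.

Lemma gin_degeneration b lt1 lt2 I J G1 G2 i j :
  weighted_order lt1 -> weighted_order lt2 -> homog_ideal I -> homog_ideal J ->
  is_gin lt1 I G1 -> is_gin lt2 J G2 ->
  exists2 g, g \in unitmx &
  (dim_Tor (ideal_or_quot b I) (quot_mod (coord_change g @` J)) i j <=
   dim_Tor (ideal_or_quot b G1) (quot_mod G2) i j)%N.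
Proof.
move=> hlt1 hlt2 hI hJ /for_general_ex[h1 h1u <-] /for_general_ex[h2 h2u <-].
have hI1 := coord_change_homog h1u hI; have hJ2 := coord_change_homog h2u hJ.
have hG1 := homog_ideal_or_quot b (init_ideal_homog hlt1 (proj1 hI1)).
(* The first argument stays fixed during a degeneration: here it is the initial ideal of the
   translate of [I], or its quotient; in the next step it is the quotient by the translate of [J]
   just found. *)
have [g2 g2u le2] := torus_degeneration true i j hlt2 hG1 hJ2.
have hJ' := coord_change_homog g2u hJ2.
have hQ := homog_quot_mod hJ'.
have [g1 g1u le1] := torus_degeneration b i j hlt1 hQ hI1.
have au : g1 *m h1 \in unitmx by rewrite unitmx_mul g1u.
have vu : invmx (g1 *m h1) \in unitmx by rewrite unitmx_inv.
have hI' := homog_ideal_or_quot b (coord_change_homog g1u hI1).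
have eI : coord_change (invmx (g1 *m h1)) @`
    (coord_change g1 @` (coord_change h1 @` I)) = I.
  by rewrite (coord_change_image_comp g1 h1 I); exact: coord_change_imageV.
have eJ : coord_change (invmx (g1 *m h1)) @`
    (coord_change g2 @` (coord_change h2 @` J)) =
    coord_change (invmx (g1 *m h1) *m (g2 *m h2)) @` J.
  by rewrite (coord_change_image_comp g2 h2 J); exact: coord_change_image_comp.
exists (invmx (g1 *m h1) *m (g2 *m h2)).
  by rewrite unitmx_mul vu unitmx_mul g2u.
(* Only the second argument of Tor may move in [torus_degeneration], so the degeneration on the side
   of [I] is read through [dim_TorC]. *)
apply: leq_trans le2; rewrite [X in (_ <= X)%N](dim_TorC i j hG1 hQ).
apply: leq_trans le1; rewrite [X in (_ <= X)%N](dim_TorC i j hQ hI').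
rewrite -(dim_Tor_change i j vu hI' hQ) (change_ideal_or_quot b _ vu).
by rewrite (change_quot_mod _ vu) eI eJ; exact: leqnn.
Qed.

Lemma generic_dim_Tor_le b I J g0 i j : homog_ideal I -> homog_ideal J ->
  g0 \in unitmx -> generic (fun u => vec_mx u \in unitmx ->
    (dim_Tor (ideal_or_quot b I) (quot_mod (coord_change (vec_mx u) @` J)) i j <=
     dim_Tor (ideal_or_quot b I) (quot_mod (coord_change g0 @` J)) i j)%N).
Proof.
move=> hI hJ g0u; have hM := homog_ideal_or_quot b hI.
have [D hD] := dim_Tor_semicontinuous i j hM.
have fam d := @family_change K n [set u | vec_mx u \in unitmx] J d hJ (fun _ h => h).
exists (mxvec g0); rewrite -{2}(mxvecK g0).
apply: (hD _ [set u | vec_mx u \in unitmx]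
  (fun u => ideal_or_quot true (coord_change (vec_mx u) @` J))).
- by move=> u uu; apply: homog_ideal_or_quot; exact: coord_change_homog.
- by move=> d _; have [] := family_ideal_or_quot true (fam d).
- by move=> d _; have [] := family_ideal_or_quot true (fam d).
- by rewrite /mkset mxvecK.
Qed.

End Comparison.

Theorem theorem2p8 (K : fieldType) (hK : infinite_set [set: K]) (n : nat)
    (j : int) (I J : set {mpoly K[n]})
    (hI : homog_ideal I) (hJ : homog_ideal J) :
  for_general (fun g : 'M[K]_n =>
    (forall i : nat,
      (dim_Tor (quot_mod I) (quot_mod (coord_change g @` J)) i j <=
       dim_Tor (quot_mod (Gin (@lex_lt n) I))
               (quot_mod (Gin (@oplex_lt n) J)) i j)%N) /\
    (forall i : nat,
      (dim_Tor (ideal_mod I) (quot_mod (coord_change g @` J)) i j <=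
       dim_Tor (ideal_mod (Gin (@lex_lt n) I))
               (quot_mod (Gin (@oplex_lt n) J)) i j)%N)).
Proof.
have ginI : is_gin (@lex_lt n) I (Gin (@lex_lt n) I).
  exact: (xgetPex set0 (gin_exists hK (@lex_weighted n) hI)).
have ginJ : is_gin (@oplex_lt n) J (Gin (@oplex_lt n) J).
  exact: (xgetPex set0 (gin_exists hK (@oplex_weighted n) hJ)).
set G1 := Gin (@lex_lt n) I in ginI *; set G2 := Gin (@oplex_lt n) J in ginJ *.
(* [|j| + 2] is the first index at which [dim_Tor_eq0] applies, which leaves finitely many open sets
   to intersect. *)
have gen b : generic (fun u : 'rV[K]_(n * n) => forall i, (i < `|j|.+2)%N ->
    vec_mx u \in unitmx ->
    (dim_Tor (ideal_or_quot b I) (quot_mod (coord_change (vec_mx u) @` J)) i j <=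
     dim_Tor (ideal_or_quot b G1) (quot_mod G2) i j)%N).
  apply: (generic_lt hK) => i _.
  have [g0 g0u le0] := gin_degeneration hK b i j (@lex_weighted n) (@oplex_weighted n)
    hI hJ ginI ginJ.
  apply: genericS (generic_dim_Tor_le b i j hI hJ g0u) => u h uu.
  exact: leq_trans (h uu) le0.
apply: (for_general_generic hK).
apply: genericS (genericI hK (gen true) (gen false)) => u [hq hi] uu.
have hJu := homog_quot_mod (coord_change_homog uu hJ).
split=> i; have [ij|ij] := ltnP i `|j|.+2.
- exact: hq.
- by rewrite dim_Tor_eq0 //; exact: homog_quot_mod.
- exact: hi.
- by rewrite dim_Tor_eq0 //; exact: homog_ideal_mod.
Qed.
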